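(* Let $\phi\colon\mathbb{R}^n\to\phi(\mathbb{R}^n)=\mathbb{R}^n$ be a homeomorphism with $\phi(0)=0$ such that $\langle\phi(\xi),\xi\rangle>0$ for every $\xi\in\mathbb{R}^n\setminus\{0\}$, and for every $\eta>0$ there exists $M_\eta>0$ such that $\langle\phi(\xi),\xi\rangle\ge\eta\|\xi\|-M_\eta$ for all $\xi\in\mathbb{R}^n$. Let $\mathcal{G}\colon\mathbb{R}^n\to\mathbb{R}$ be a $\mathcal{C}^2$-function. Let $p\colon[0,T]\to\mathbb{R}^n$ be a continuous function with $\int_0^Tp(t)\,\mathrm{d}t=0$. Let $h=h(t,x)\colon[0,T]\times\mathbb{R}^n\to\mathbb{R}^n$ be a continuous function for which there exists $K_0>0$ such that $\langle h(t,x),x\rangle\ge-K_0$ for all $t\in[0,T]$ and $x\in\mathbb{R}^n$. Moreover, suppose that at least one of the following three conditions holds: (i) $\langle h(t,x),x\rangle\to+\infty$ as $\|x\|\to+\infty$, uniformly in $t$; (ii) for every $\rho>0$ there exists $R_\rho>0$ such that $\langle h(t,x+y),x\rangle\ge0$ for all $t\in[0,T]$ and all $(x,y)\in\mathbb{R}^{2n}$ with $\|x\|>R_\rho$ and $\|y\|\le\rho$; (iii) there exists $d>0$ such that, for every $i=1,\dots,n$, $h_i(t,x)x_i\ge0$ for every $t\in[0,T]$ and every $x=(x_1,\dots,x_n)\in\mathbb{R}^n$ with $|x_i|>d$. Then the problem $$(\phi(x'))'=\frac{\mathrm{d}}{\mathrm{d}t}\nabla\mathcal{G}(x)+h(t,x)+p(t),\qquad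 x(0)=x(T),\quad x'(0)=x'(T)$$ has at least one solution.
   Context: $T>0$ and $n\ge1$ are fixed. $\|\cdot\|$ and $\langle\cdot,\cdot\rangle$ are the Euclidean norm and standard inner product on $\mathbb{R}^n$; $h_i$ denotes the $i$-th component of $h$. In the equation, $\frac{\mathrm{d}}{\mathrm{d}t}\nabla\mathcal{G}(x)$ stands for $\frac{\mathrm{d}}{\mathrm{d}t}\bigl[\nabla\mathcal{G}(x(t))\bigr]$. A solution of the problem is a continuously differentiable function $x\colon[0,T]\to\mathbb{R}^n$ such that $t\mapsto\phi(x'(t))$ is continuously differentiable, the equation holds for all $t\in[0,T]$, and the boundary conditions hold. *)

(* Defs.v *)
From HB Require Import structures.
From mathcomp Require Import all_boot all_order all_algebra.
From mathcomp Require Import all_classical all_reals all_analysis.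

Set Implicit Arguments.
Unset Strict Implicit.
Unset Printing Implicit Defensive.

Import Order.TTheory GRing.Theory Num.Theory.
Import numFieldNormedType.Exports.

Local Open Scope classical_set_scope.
Local Open Scope ring_scope.

(* R^n is 'rV[R]_n. The norm that MathComp-Analysis puts on it is the sup norm
   (with the usual topology), so the Euclidean structure is defined here. *)

Definition inner (R : realType) (n : nat) (u v : 'rV[R]_n) : R :=
  \sum_(i < n) u 0 i * v 0 i.

Definition enorm (R : realType) (n : nat) (u : 'rV[R]_n) : R :=
  Num.sqrt (inner u u).

Definition homeomorphism (X Y : topologicalType) (f : X -> Y) : Prop :=
  continuous f /\
  exists g : Y -> X, [/\ continuous g, cancel f g & cancel g f].

Definition partial (R : realType) (n : nat) (f : 'rV[R]_n -> R) (i : 'I_n) :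
    'rV[R]_n -> R :=
  'D_(delta_mx 0 i) f.

Definition grad (R : realType) (n : nat) (f : 'rV[R]_n -> R) (x : 'rV[R]_n) :
    'rV[R]_n :=
  \row_i partial f i x.

Definition class_C1 (R : realType) (n : nat) (f : 'rV[R]_n -> R) : Prop :=
  forall i : 'I_n,
    (forall x : 'rV[R]_n, derivable f x (delta_mx 0 i)) /\
    continuous (partial f i).

Definition class_C2 (R : realType) (n : nat) (f : 'rV[R]_n -> R) : Prop :=
  class_C1 f /\ forall i : 'I_n, class_C1 (partial f i).

(* [f] has derivative [df] on [a, b], one-sided at [a] and [b]; a function on
   [a, b] is a total function whose values outside [a, b] play no role. *)
Definition derivative_on (R : realType) (n : nat) (a b : R)
    (f df : R -> 'rV[R]_n) : Prop :=
  forall t : R, t \in `[a, b] ->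
    (s - t)^-1 *: (f s - f t) @[s --> within `[a, b] t^'] --> df t.

Definition C1_on (R : realType) (n : nat) (a b : R)
    (f df : R -> 'rV[R]_n) : Prop :=
  derivative_on a b f df /\ {within `[a, b], continuous df}.

(* [dx], [dphi] and [dgrad] are x', (phi(x'))' and d/dt [grad G (x(t))]. *)
Definition periodic_solution (R : realType) (n : nat) (T : R)
    (phi : 'rV[R]_n -> 'rV[R]_n) (G : 'rV[R]_n -> R)
    (h : R -> 'rV[R]_n -> 'rV[R]_n) (p : R -> 'rV[R]_n)
    (x : R -> 'rV[R]_n) : Prop :=
  exists dx dphi dgrad : R -> 'rV[R]_n,
    [/\ C1_on 0 T x dx,
        C1_on 0 T (phi \o dx) dphi,
        derivative_on 0 T (grad G \o x) dgrad,
        forall t : R, t \in `[0, T] -> dphi t = dgrad t + h t (x t) + p t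
      & x 0 = x T /\ dx 0 = dx T].

(* Main.v *)
Require Import Defs.
From HB Require Import structures.
From mathcomp Require Import all_boot all_order all_algebra.
From mathcomp Require Import all_classical all_reals all_analysis.
From mathcomp Require Import ring lra.

Import Order.TTheory GRing.Theory Num.Theory.
Import numFieldNormedType.Exports.

Local Open Scope classical_set_scope.
Local Open Scope ring_scope.

(** The equation is replaced by a finite difference scheme with the same
    energy identity; the scheme is solved by a theorem of Brouwer type, its
    solutions are bounded independently of the mesh, and the mesh tends to 0.

    The scheme.  Let [P] be a primitive of [p]; since [p] has mean zero,
    [P 0 = P T].  Let [g] be a discrete gradient of [G]: a continuous map with
    <g u v, v - u> = G v - G u and g x x = grad G x ([diffquot]).  With [N]
    steps of length [T / N] and [eps = 1 / N], look for [N]-periodic sequences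
    X, W with, for k < N and t_k = k T / N,

      W_k = phi (Y_k) - g X_k X_(k+1) - P (t_k),   Y_k = (X_(k+1) - X_k) N / T,
      W_(k+1) - W_k = (T / N) (h (t_k, X_(k+1)) + eps X_(k+1)).

    Pair the second line with X_(k+1) and sum by parts.  The contribution of
    [G] telescopes over a period, and the coercivity of [phi], taken with a
    slope larger than sup |P|, bounds what is left from below ([energy_ge]).
    With the term in [eps] this makes the scheme a vector field that points
    outwards on a large sphere, so it has a zero ([coercive_zero],
    [discrete_solution_exists]).

    The bounds.  The same identity bounds the total variation of X by a
    constant that does not depend on [N] and [eps].  It remains to bound X_0.
    Under (i) the energy identity itself forbids large X.  Under (ii) and
    (iii), if X_0 is large then all the h (t_k, X_(k+1)) and all the X_(k+1)
    have a common direction, whereas the sum of h + eps X over a period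
    vanishes ([no_common_direction]).  Now h is bounded along the solutions,
    so W varies by a bounded amount; one slope Y_k is at most the mean slope,
    so W is bounded at that k and hence everywhere.  As
    Y_k = phi^-1 (W_k + g X_k X_(k+1) + P (t_k)) and phi is a homeomorphism,
    the slopes are bounded: they are recovered pointwise, by inverting [phi],
    from quantities whose increments are O(1/N).

    The limit.  X and W have increments O(1/N), so along an ultrafilter on the
    mesh sizes they converge, locally uniformly in time, to functions x and w
    ([increments_limit]).  Then Y converges to
    y = phi^-1 (w + grad G (x) + P), and the two difference equations become
    x' = y and w' = h (t, x) ([increments_derivative]).  Hence
    phi (x') = w + grad G (x) + P has derivative h + d/dt grad G (x) + p.

    The topological input [coercive_zero] follows from Kuhn's lemma on
    labelled cubes ([kuhn_cube]): if each coordinate has a 0-1 label that is 0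
    on one face of a grid and 1 on the opposite face, some small cube carries
    both values of every label.  On a discrete torus, correct the differential
    of each label on the edges that wrap around.  The cup product mod 2 of the
    corrected forms has the same total mass, 1, as the product of the
    wrap-around forms, so it is nonzero at some cube; there no corrected form
    vanishes, which excludes the wrap-around cubes. *)

Set Implicit Arguments.
Unset Strict Implicit.
Unset Printing Implicit Defensive.

(** * Cubical cochains modulo 2 *)

Section CubicalForms.
Variables (I : finType) (P : zmodType) (e : I -> P).
Implicit Types (i j : I) (q u : P) (S : {set I}).
Implicit Types (w : {set I} -> P -> 'F_2) (th : I -> P -> 'F_2).

(** [w S q] is the value of the cochain [w] on the cube with corner [q] and
    edge directions [S]; over [ 'F_2 ] no orientation is needed. *)
Definition coboundary w S q : 'F_2 :=
  \sum_(i in S) (w (S :\ i)%SET (q + e i) + w (S :\ i)%SET q).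

Definition cup th w S q : 'F_2 :=
  \sum_(i in S) th i q * w (S :\ i)%SET (q + e i).

Definition closed_form th : Prop :=
  forall i j q, th i q + th j (q + e i) = th j q + th i (q + e j).

Lemma addF2 (x : 'F_2) : x + x = 0.
Proof. by case: x => [[|[|?]] ?] //; apply/val_inj. Qed.

Lemma sum_symmetric_offdiag (f : I -> I -> 'F_2) S :
  (forall i j, f i j = f j i) ->
  \sum_(i in S) \sum_(j in (S :\ i)%SET) f i j = 0.
Proof.
move=> fC; rewrite pair_big_dep /=.
rewrite (bigID (fun p : I * I => (enum_rank p.1 < enum_rank p.2)%N)) /=.
set a := (X in X + _ = _); set b := (X in _ + X = _).
suff -> : b = a by exact: addF2.
rewrite /a /b (reindex_inj (h := fun p : I * I => (p.2, p.1))) /=; last first.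
  by move=> [? ?] [? ?] [-> ->].
apply: eq_big => [[i j]|[i j] _] /=; last exact: fC.
rewrite !in_setD1 -leqNgt leq_eqVlt.
have -> : (enum_rank i == enum_rank j :> nat) = (i == j).
  by rewrite -(inj_eq enum_rank_inj).
rewrite (eq_sym j i); case: eqVneq => [->|] /=; first by rewrite !andbF.
by rewrite (andbC (j \in S)).
Qed.

(** The Leibniz rule for a closed 1-form.  Once the terms that cancel in pairs
    are removed, the difference of the two sides is a double sum over distinct
    directions whose summand is symmetric because [th] is closed. *)
Lemma coboundary_cup th w S q : closed_form th ->
  coboundary (cup th w) S q = cup th (coboundary w) S q.
Proof.
move=> cth; apply/eqP; rewrite -subr_eq0 -[- cup _ _ _ _]addr0.
rewrite -[X in - _ + X](addF2 (cup th (coboundary w) S q)) addKr; apply/eqP.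
have swap (f : I -> I -> 'F_2) :
    \sum_(i in S) \sum_(j in (S :\ i)%SET) f i j =
    \sum_(i in S) \sum_(j in (S :\ i)%SET) f j i.
  rewrite (exchange_big_dep (mem S)) /=; last by move=> i j _; case/setD1P.
  apply: eq_bigr => j jS; apply: eq_bigl => i.
  by rewrite !in_setD1 jS andbT (eq_sym j) andbC.
pose A i j := th j (q + e i) * w (S :\ i :\ j)%SET (q + e i + e j).
pose B i j := th i q * w (S :\ j :\ i)%SET (q + e i).
pose C i j := th i q * w (S :\ i :\ j)%SET (q + e i + e j).
have setC2 i j : (S :\ i :\ j = S :\ j :\ i)%SET.
  by rewrite !finset.setDDl finset.setUC.
have -> : coboundary (cup th w) S q =
    \sum_(i in S) \sum_(j in (S :\ i)%SET) A i j +
    \sum_(i in S) \sum_(j in (S :\ i)%SET) B i j.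
  rewrite (swap B) -big_split /=; apply: eq_bigr => i iS.
  by [].
have -> : cup th (coboundary w) S q =
    \sum_(i in S) \sum_(j in (S :\ i)%SET) C i j +
    \sum_(i in S) \sum_(j in (S :\ i)%SET) B i j.
  rewrite -big_split /=; apply: eq_bigr => i iS.
  rewrite mulr_sumr -big_split; apply: eq_bigr => j _ /=.
  by rewrite mulrDr /B /C (setC2 j i).
rewrite addrACA addF2 addr0 -big_split /=.
under eq_bigr => i _ do rewrite -big_split /=.
apply: sum_symmetric_offdiag => i j.
rewrite /A /C (setC2 j i) -!mulrDl (addrAC q) [th j _ + _]addrC.
by rewrite [th i (_ + _) + _]addrC (cth i j).
Qed.

Definition diff_form (al : P -> 'F_2) i q := al (q + e i) + al q.

Lemma diff_form_closed al : closed_form (diff_form al).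
Proof.
move=> i j q; rewrite /diff_form (addrAC q (e j)).
have E (x y z : 'F_2) : x + y + (z + x) = y + z.
  by rewrite addrC -addrA (addrA x) addF2 add0r addrC.
by rewrite !E.
Qed.

Lemma cup_diff_form al w S q : (forall S q, coboundary w S q = 0) ->
  cup (diff_form al) w S q = coboundary (fun T u => al u * w T u) S q.
Proof.
move=> w0; apply/eqP; rewrite -subr_eq0 -sumrB; apply/eqP.
transitivity (al q * coboundary w S q); last by rewrite w0 mulr0.
rewrite mulr_sumr; apply: eq_bigr => i _; rewrite /diff_form.
have N (x : 'F_2) : - x = x by apply/eqP; rewrite eq_sym -addr_eq0 addF2.
by rewrite N mulrDl mulrDr addrACA addF2 add0r.
Qed.

Definition iterated_cup (ths : I -> I -> P -> 'F_2) (s : seq I) :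
    {set I} -> P -> 'F_2 :=
  foldr (fun k => cup (ths k)) (fun S _ => (S == finset.set0)%:R) s.

Lemma iterated_cup_closed (ths : I -> I -> P -> 'F_2) s S q : (forall k, closed_form (ths k)) ->
  coboundary (iterated_cup ths s) S q = 0.
Proof.
move=> cth; elim: s S q => [|k s IH] S q /=.
  by apply: big1 => i _; exact: addF2.
rewrite coboundary_cup //; apply: big1 => i _.
by rewrite IH mulr0.
Qed.

(** A cup product is a sum over the monotone edge paths across the cube, each
    term being a product of values along the path.  If the sum is nonzero, some
    path has all its factors nonzero, and each factor sits on an edge of the
    cube. *)
Lemma iterated_cup_neq0 (ths : I -> I -> P -> 'F_2) s S q k : iterated_cup ths s S q != 0 -> k \in s ->
  exists i (T : {set I}),
    [/\ i \in S, T \subset S, i \notin T & ths k i (q + \sum_(j in T) e j) != 0].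
Proof.
elim: s S q => //= k' s IH S q nz.
have [i iS] : exists2 i, i \in S &
    ths k' i q * iterated_cup ths s (S :\ i)%SET (q + e i) != 0.
  apply/exists_inP; apply: contraNT nz; rewrite negb_exists_in.
  move=> /forall_inP z; rewrite /cup big1 // => i iS.
  by apply/eqP; have := z i iS; rewrite negbK.
rewrite mulf_eq0 negb_or => /andP[nz1 nz2].
rewrite inE => /predU1P[->|ks].
  by exists i, finset.set0; rewrite big_set0 addr0 inE finset.sub0set.
have [i' [T [/setD1P[ii' i'S] TS i'T nz3]]] := IH _ _ nz2 ks.
have iT : i \notin T by apply/negP => /(fintype.subsetP TS); rewrite !inE eqxx.
exists i', (i |: T)%SET; split => //.
- rewrite finset.subUset finset.sub1set iS (fintype.subset_trans TS) //.
  exact: finset.subD1set.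
- by rewrite !inE negb_or ii'.
- by rewrite big_setU1 //= addrA.
Qed.

End CubicalForms.

(** * Kuhn's lemma on a discrete torus *)

Section Kuhn.
Variables (I : finType) (m : nat).
Notation P := {ffun I -> 'I_m.+2}.
Implicit Types (q u : P) (i j k : I).

(** Grid points form the torus [(Z/(m+2))^I]: summing over all of them is then
    invariant under [unit_step], so coboundaries have sum zero. *)
Definition unit_step i : P := [ffun j => (j == i)%:R].

Lemma ord_maxS : ord_max + 1 = 0 :> 'I_m.+2.
Proof. by apply/val_inj; rewrite /= addn1 modnn. Qed.

Definition wrap_form k i q : 'F_2 := ((i == k) && (q k == ord_max))%:R.

Lemma wrap_form_closed k : closed_form unit_step (wrap_form k).
Proof.
move=> i j q; rewrite /wrap_form !ffunE.
have [ik|ik] := eqVneq i k; have [jk|jk] := eqVneq j k => //=;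
  by rewrite ?addr0 ?add0r.
Qed.

(** The label jumps from 1 back to 0 when coordinate [k] wraps around; adding
    [wrap_form k] removes that jump and makes the form vanish on all the edges
    of a cube that wraps around in direction [k]. *)
Definition label_form (al : I -> P -> 'F_2) k i q :=
  diff_form unit_step (al k) i q + wrap_form k i q.

Lemma label_form_closed al k : closed_form unit_step (label_form al k).
Proof.
move=> i j q; rewrite /label_form addrACA [RHS]addrACA.
by rewrite (wrap_form_closed k i j) (diff_form_closed unit_step (al k) i j).
Qed.

(** Peel off the first coordinate [k]: the exact part of its form contributes
    the sum of a coboundary, that is 0, and the wrap-around part contributes the
    same sum for the remaining coordinates, on the slice where coordinate [k]
    is 0. *)
Lemma sum_iterated_cup al s : uniq s ->
  \sum_(q : P | [forall i, (i \notin s) ==> (q i == 0)])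
    iterated_cup unit_step (label_form al) s [set i in s]%SET q = 1.
Proof.
elim: s => [_|k s IH /= /andP[ks us]].
  rewrite (big_pred1 (0 : P)) => [|q] /=.
    by rewrite (_ : [set i in [::]]%SET = finset.set0) ?eqxx //; apply/setP => i; rewrite !inE.
  apply/forallP/eqP => [q0|-> i]; last first.
    by apply/eqP; exact: ffunE.
  by apply/ffunP => i; rewrite [RHS]ffunE; have /eqP := q0 i.
set S := [set i in k :: s]%SET; set w := iterated_cup unit_step (label_form al) s.
set pr := fun q : P => [forall i, (i \notin k :: s) ==> (q i == 0)].
have kS : k \in S by rewrite !inE eqxx.
have split q : cup unit_step (label_form al k) w S q =
    cup unit_step (diff_form unit_step (al k)) w S q +
    (q k == ord_max)%:R * w [set i in s]%SET (q + unit_step k).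
  transitivity (cup unit_step (diff_form unit_step (al k)) w S q + cup unit_step (wrap_form k) w S q).
    by rewrite -big_split; apply: eq_bigr => i _ /=; rewrite -mulrDl.
  congr (_ + _); rewrite /cup (bigD1 k) //= big1 ?addr0 => [|i /andP[_ /negPf ik]].
    rewrite /wrap_form eqxx /=; congr (_ * w _ _).
    by apply/setP => i; rewrite !inE; case: eqVneq => [->|]; rewrite ?(negPf ks).
  by rewrite /wrap_form ik mul0r.
rewrite (eq_bigr _ (fun q _ => split q)) big_split /=.
rewrite [X in X + _](_ : _ = 0) ?add0r; last first.
  transitivity (\sum_(i in S) \sum_(q | pr q)
     (al k (q + unit_step i) * w (S :\ i)%SET (q + unit_step i) + al k q * w (S :\ i)%SET q)).
    rewrite [RHS]exchange_big /=; apply: eq_bigr => q _; apply: cup_diff_form => S1 q1.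
    by apply: iterated_cup_closed => k'; exact: label_form_closed.
  apply: big1 => i iS; rewrite big_split /=.
  rewrite [X in _ + X](reindex_inj (addIr (unit_step i))) /=.
  rewrite [X in _ + X](eq_bigl pr) ?addF2 // => q.
  apply: eq_forallb => j; rewrite !ffunE.
  have [->|ji] := eqVneq j i; first by move: iS; rewrite inE => ->.
  by rewrite addr0.
rewrite -[RHS](IH us) (reindex_inj (addIr (- unit_step k))) /=.
rewrite big_mkcond [RHS]big_mkcond /=; apply: eq_bigr => q _; rewrite subrK.
have -> : ((q - unit_step k) k == ord_max) = (q k == 0).
  by rewrite !ffunE eqxx subr_eq ord_maxS.
rewrite [X in (if X then _ else _) = _](_ : _ = [forall i, (i \notin k :: s) ==> (q i == 0)]); last first.
  apply: eq_forallb => j; rewrite !ffunE inE negb_or.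
  by case: eqVneq => //=; rewrite subr0.
case: ifPn => [/forallP q0|q0].
  have [qk|qk] := eqVneq (q k) 0.
    rewrite mul1r; case: ifPn => // /forallP; case => j; apply/implyP => js.
    have [->|jk] := eqVneq j k; first by rewrite qk.
    by have /implyP := q0 j; rewrite inE negb_or jk; apply.
  rewrite mul0r; case: ifPn => // /forallP /(_ k); by rewrite ks (negPf qk).
case: ifPn => // /forallP q1; case/forallP: q0 => j.
by apply/implyP => js; apply: (implyP (q1 j)); move: js; rewrite inE negb_or => /andP[].
Qed.

(** The cube with corner [q] is one where the iterated cup product of the label
    forms is nonzero.  Form [j] vanishes on all edges of a cube that wraps around
    in direction [j], so no coordinate of [q] is maximal; then each label form is
    the differential of its label, and a nonzero value is a change of label. *)
Lemma kuhn_cube (al : I -> P -> bool) :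
  (forall k q, q k = ord0 -> al k q = false) ->
  (forall k q, q k = ord_max -> al k q = true) ->
  exists q : P, forall k, exists u v : P,
    [/\ al k u, ~~ al k v,
       forall j, (q j <= u j <= (q j).+1)%N
     & forall j, (q j <= v j <= (q j).+1)%N].
Proof.
move=> al0 al1.
pose a k q : 'F_2 := (al k q)%:R.
have [q nz] : exists q, iterated_cup unit_step (label_form a) (enum I) [set: I]%SET q != 0.
  apply/existsP; rewrite -[X in is_true X]negbK negb_exists; apply/negP => /forallP z.
  have := sum_iterated_cup a (enum_uniq I); rewrite big1 => [/eqP|q _].
    by rewrite eq_sym oner_eq0.
  rewrite (_ : [set i in enum I]%SET = [set: I]%SET); last first.
    by apply/setP => i; rewrite !inE mem_enum.
  by apply/eqP; have := z q; rewrite negbK.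
have sE (T : {set I}) : \sum_(j in T) unit_step j = [ffun i => (i \in T)%:R].
  apply/ffunP => i; rewrite sum_ffunE ffunE.
  under eq_bigr => j _ do rewrite ffunE.
  have [iT|iT] := boolP (i \in T).
    rewrite (bigD1 i) //= eqxx big1 ?addr0 // => j /andP[_ /negPf].
    by rewrite eq_sym => ->.
  by apply: big1 => j jT; case: eqVneq => // ij; rewrite ij jT in iT.
have edge k : exists (i : I) (u : P), [/\ label_form a k i u != 0, u i = q i &
    forall j, exists b : bool, u j = q j + b%:R].
  have [i [T [_ _ iT nzk]]] := iterated_cup_neq0 nz (mem_enum I k).
  exists i, (q + \sum_(j in T) unit_step j); split => //.
    by rewrite sE !ffunE (negPf iT) addr0.
  by move=> j; exists (j \in T); rewrite sE !ffunE.
have qmax j : (q j < m.+1)%N.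
  rewrite ltn_neqAle -ltnS ltn_ord andbT; apply/negP => /eqP qj.
  have {}qj : q j = ord_max by exact/val_inj.
  have [i [u [+ ui uj]]] := edge j.
  rewrite /label_form /diff_form /wrap_form /a.
  have [ij|ij] := eqVneq i j.
    subst i; rewrite ui qj eqxx /= (al1 j u) ?ui // al0 ?add0r ?addF2 ?eqxx //.
    by rewrite !ffunE eqxx ui qj ord_maxS.
  have ue : (u + unit_step i) j = u j by rewrite !ffunE eq_sym (negPf ij) addr0.
  have [[] uj'] := uj j; rewrite qj in uj'; last first.
    rewrite addr0 in uj'.
    by rewrite !al1 ?ue // addF2 addr0 eqxx.
  by rewrite uj' ord_maxS in ue *; rewrite ord_maxS in uj'; rewrite !al0 // addF2 addr0 eqxx.
exists q => k.
have [i [u [nzk ui uj]]] := edge k.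
have valS j : val (q j + 1) = (q j).+1.
  by rewrite /= modn_small ?addn1 // ltnS; exact: qmax.
have near_u j : (q j <= u j <= (q j).+1)%N.
  have [[] ->] := uj j; rewrite ?addr0 ?leqnn ?leqnSn //.
  by rewrite -[nat_of_ord _]/(val _) valS leqnSn leqnn.
have near_u' j : (q j <= (u + unit_step i : P)%R j <= (q j).+1)%N.
  have -> : (u + unit_step i) j = u j + (j == i)%:R by rewrite !ffunE.
  have [->|_] := eqVneq j i; last by rewrite addr0 near_u.
  by rewrite ui -[nat_of_ord (_ + _)%R]/(val _) valS leqnSn leqnn.
move: nzk; rewrite /label_form /diff_form /wrap_form /a.
have -> : (i == k) && (u k == ord_max) = false.
  apply/negP => /andP[/eqP ik /eqP]; rewrite -ik ui => qi.
  by have := qmax i; rewrite qi ltnn.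
rewrite addr0.
have [au|au] := boolP (al k u); have [au'|au'] := boolP (al k (u + unit_step i));
  rewrite ?addF2 ?eqxx // => _.
- by exists u, (u + unit_step i).
- by exists (u + unit_step i), u.
Qed.

End Kuhn.

(** * Limits of matrices *)

Section MatrixTools.
Context {R : realType}.

Lemma mx_norm_leP a b (x : 'M[R]_(a, b)) (e : R) : 0 <= e ->
  `|x| <= e <-> forall i j, `|x i j| <= e.
Proof.
move=> e0; rewrite [`|x|]/Num.norm /= mx_normrE; split.
  by move/bigmax_leP => [_ xe] i j; exact: (xe (i, j)).
by move=> xe; apply/bigmax_leP; split => // -[i j] _; exact: xe.
Qed.

Lemma mx_entry_le a b (x : 'M[R]_(a, b)) i j : `|x i j| <= `|x|.
Proof. by move: i j; apply/mx_norm_leP. Qed.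

Lemma cvg_mxP {T : Type} {F : set_system T} {FF : Filter F} a b
    (u : T -> 'M[R]_(a, b)) (l : 'M[R]_(a, b)) :
  u @ F --> l <-> forall i j, (fun t => u t i j) @ F --> l i j.
Proof.
split=> [ul i j|ul].
  apply: (@cvg_comp _ _ _ u (fun M : 'M[R]_(a, b) => M i j) F _ _ ul).
  exact: coord_continuous.
apply/cvgrPdist_le => e e0.
have H : \forall t \near F, forall ij : 'I_a * 'I_b,
    `|l ij.1 ij.2 - u t ij.1 ij.2| <= e.
  by apply: filter_forall => -[i j]; move/cvgrPdist_le: (ul i j); exact.
apply: filterS H => t H; apply/mx_norm_leP; first exact: ltW.
by move=> i j; rewrite !mxE; exact: (H (i, j)).
Qed.

Lemma ultra_cvg_real {T : Type} {F : set_system T} (UF : UltraFilter F)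
    (u : T -> R) (B : R) :
  (\forall t \near F, `|u t| <= B) -> exists l : R, u @ F --> l.
Proof.
move=> uB.
have [l [_ ucl]] : `[- B, B] `&` cluster (u @ F) !=set0.
  apply: (@segment_compact R (- B) B (u @ F)).
  by apply: filterS uB => t; rewrite /= in_itv /= ler_norml.
exists l => A lA.
have [//|FA] := in_ultra_setVsetC (u @^-1` A) UF.
by have [y [/= ]] := ucl (~` A) A FA lA.
Qed.

Lemma ultra_cvg_mx {T : Type} {F : set_system T} (UF : UltraFilter F) a b
    (u : T -> 'M[R]_(a, b)) (B : R) :
  (\forall t \near F, `|u t| <= B) -> exists l : 'M[R]_(a, b), u @ F --> l.
Proof.
move=> uB.
have /choice [l ul] : forall ij : 'I_a * 'I_b,
    exists l : R, (fun t => u t ij.1 ij.2) @ F --> l.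
  move=> ij; apply: (ultra_cvg_real UF (B := B)).
  by apply: filterS uB => t; apply: le_trans; exact: mx_entry_le.
exists (\matrix_(i, j) l (i, j)); apply/cvg_mxP => i j.
by rewrite mxE; exact: (ul (i, j)).
Qed.

Lemma cvg_norm_le {T : Type} {F : set_system T} {FF : ProperFilter F}
    (V : normedModType R) (u : T -> V) (l : V) (B : R) :
  u @ F --> l -> (\forall t \near F, `|u t| <= B) -> `|l| <= B.
Proof.
move=> ul uB; apply: (closed_cvg (fun z : V => `|z| <= B) _ uB _ ul).
by apply: (closed_comp _ (@closed_le _ B)) => z _; exact: norm_continuous.
Qed.

End MatrixTools.

(** * Zeros of outward pointing fields *)

Section CoerciveZero.
Context {R : realType}.

Lemma exists_ultra_nat : exists U : set_system nat, UltraFilter U /\ \oo `<=` U.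
Proof. exact: ultraFilterLemma. Qed.

(** Brouwer's theorem for cubes, in the form of a zero of a field that points
    outwards.  Label a grid point of the cube of side [2 r] by the signs of the
    entries of [F], forced on the faces.  The cubes of Kuhn's lemma shrink to a
    point [x] where each entry of [F x] is 0, or has sign opposite to that of
    [x] on a face.  On the boundary this contradicts the hypothesis. *)
Lemma coercive_zero a b (F : 'M[R]_(a, b) -> 'M[R]_(a, b)) (r : R) :
  0 < r -> continuous F ->
  (forall x, `|x| = r -> 0 < \sum_i \sum_j F x i j * x i j) ->
  exists x, F x = 0.
Proof.
move=> r0 cF Fpos.
have [U [UU ooU]] := exists_ultra_nat.
pose I := ('I_a * 'I_b)%type.
pose pt m (q : {ffun I -> 'I_m.+2}) : 'M[R]_(a, b) :=
  \matrix_(i, j) (r * (2 * (q (i, j))%:R / m.+1%:R - 1)).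
pose al m (k : I) (q : {ffun I -> 'I_m.+2}) : bool :=
  (q k == ord_max) || ((q k != ord0) && (0 < F (pt m q) k.1 k.2)).
have mp m : (0 : R) < m.+1%:R by rewrite ltr0n.
have pt_lo m (q : {ffun I -> 'I_m.+2}) (k : I) : q k = ord0 -> pt m q k.1 k.2 = - r.
  by case: k => i j qk; rewrite mxE qk mulr0 mul0r sub0r mulrN1.
have pt_hi m (q : {ffun I -> 'I_m.+2}) (k : I) : q k = ord_max -> pt m q k.1 k.2 = r.
  case: k => i j qk; rewrite mxE qk /= mulfK ?gt_eqF //.
  by rewrite -[X in _ - X](mulr1n 1) -[2]/(1 + 1) addrK mulr1.
have pt_norm m q : `|pt m q| <= r.
  apply/mx_norm_leP => [|i j]; first exact: ltW.
  rewrite mxE normrM gtr0_norm //; apply: ler_piMr; first exact: ltW.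
  have y0 : 0 <= 2 * (q (i, j))%:R / m.+1%:R :> R.
    by rewrite mulr_ge0 ?invr_ge0 ?mulr_ge0 ?ler0n.
  have y2 : 2 * (q (i, j))%:R / m.+1%:R <= 2 :> R.
    by rewrite ler_pdivrMr // ler_pM2l // ler_nat -ltnS.
  move: y0 y2; set y := _ / _ => y0 y2.
  by rewrite ler_norml; apply/andP; split; lra.
have pt_near m (q u : {ffun I -> 'I_m.+2}) :
    (forall k, (q k <= u k <= (q k).+1)%N) ->
    `|pt m u - pt m q| <= 2 * r / m.+1%:R.
  move=> qu; apply/mx_norm_leP => [|i j].
    by rewrite divr_ge0 ?mulr_ge0 ?ler0n // ltW.
  have /andP[q1 q2] := qu (i, j).
  rewrite !mxE; have := mp m; rewrite -invr_gt0; set c := (_)^-1 => c0.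
  set U1 := ((u _)%:R); set Q1 := ((q _)%:R).
  have -> : r * (2 * U1 * c - 1) - r * (2 * Q1 * c - 1) = 2 * r * c * (U1 - Q1) by ring.
  have p0 : 0 < 2 * r * c by rewrite !mulr_gt0.
  rewrite normrM gtr0_norm //; apply: ler_piMr; first exact: ltW.
  rewrite /U1 /Q1 -natrB // ger0_norm ?ler0n //.
  by rewrite lern1 leq_subLR addn1.
have K (m : nat) : exists c : 'M[R]_(a, b), `|c| <= r /\ forall k : I, exists u v : 'M[R]_(a, b),
    [/\ `|u - c| <= 2 * r / m.+1%:R, `|v - c| <= 2 * r / m.+1%:R,
        (u k.1 k.2 = r \/ 0 < F u k.1 k.2) &
        (v k.1 k.2 = - r \/ F v k.1 k.2 <= 0)].
  have [||q Hq] := @kuhn_cube I m (al m).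
  - by move=> k q qk; rewrite /al qk.
  - by move=> k q qk; rewrite /al qk eqxx.
  exists (pt m q); split=> [|k]; first exact: pt_norm.
  have [u [v [au av uq vq]]] := Hq k.
  exists (pt m u), (pt m v); split; [exact: pt_near|exact: pt_near| |].
    by move: au => /orP[/eqP/pt_hi|/andP[_]]; [left|right].
  move: av; rewrite /al negb_or negb_and negbK -leNgt => /andP[_].
  by move=> /orP[/eqP/pt_lo|]; [left|right].
have [c cP] := choice K.
have c_norm m : `|c m| <= r by case: (cP m).
have Hc m := proj2 (cP m).
have [x cx] : exists x : 'M[R]_(a, b), c @ U --> x.
  by apply: (ultra_cvg_mx UU (B := r)); apply: nearW.
have cvgnear (u : nat -> 'M[R]_(a, b)) :
    (forall m, `|u m - c m| <= 2 * r / m.+1%:R) -> u @ U --> x.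
  move=> uq.
  have u0 : (fun m => u m - c m) @ U --> (0 : 'M[R]_(a, b)).
    apply/cvgr0Pnorm_lt => e e0.
    apply: ooU; near=> m; apply: le_lt_trans (uq m) _.
    rewrite ltr_pdivrMr // -ltr_pdivrMl //.
    apply: (@lt_trans _ _ m%:R); last by rewrite ltr_nat.
    by near: m; exact: nbhs_infty_gtr.
  have H := cvgD u0 cx; rewrite add0r in H.
  have uE : u = (fun m => u m - c m) + c.
    by apply/funext => m; rewrite addrfctE subrK.
  by rewrite uE; exact: H.
have xr : `|x| <= r.
  by apply: (cvg_norm_le cx); apply: nearW.
have cFx : F @ x --> F x by exact: cF.
have hi (k : I) : x k.1 k.2 = r \/ 0 <= F x k.1 k.2.
  have H m : exists z : 'M[R]_(a, b),
      `|z - c m| <= 2 * r / m.+1%:R /\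
      (z k.1 k.2 = r \/ 0 < F z k.1 k.2).
    by have [u [v []]] := Hc m k; exists u.
  have [u Hu] := choice H.
  have ux : u @ U --> x by apply: cvgnear => m; case: (Hu m).
  have Fux : (fun m => F (u m) k.1 k.2) @ U --> F x k.1 k.2.
    have H1 : (fun m => F (u m)) @ U --> F x by exact: (cvg_comp _ _ ux cFx).
    by move/cvg_mxP : H1; exact.
  have [|x0] := leP 0 (F x k.1 k.2); [by right|left].
  have ur : \forall m \near U, u m k.1 k.2 = r.
    near=> m; have [_ [//|]] := Hu m.
    by rewrite ltNge; case/negP; apply: ltW; near: m; exact: (cvgr_lt _ Fux).
  apply: (@cvg_unique _ _ ((fun m => u m k.1 k.2) @ U)) => //.
    by move/cvg_mxP : ux; exact.
  by apply: cvg_near_cst.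
have lo (k : I) : x k.1 k.2 = - r \/ F x k.1 k.2 <= 0.
  have H m : exists z : 'M[R]_(a, b),
      `|z - c m| <= 2 * r / m.+1%:R /\
      (z k.1 k.2 = - r \/ F z k.1 k.2 <= 0).
    by have [u [v []]] := Hc m k; exists v.
  have [u Hu] := choice H.
  have ux : u @ U --> x by apply: cvgnear => m; case: (Hu m).
  have Fux : (fun m => F (u m) k.1 k.2) @ U --> F x k.1 k.2.
    have H1 : (fun m => F (u m)) @ U --> F x by exact: (cvg_comp _ _ ux cFx).
    by move/cvg_mxP : H1; exact.
  have [|x0] := leP (F x k.1 k.2) 0; [by right|left].
  have ur : \forall m \near U, u m k.1 k.2 = - r.
    near=> m; have [_ [//|]] := Hu m.
    by rewrite leNgt; case/negP; near: m; exact: (cvgr_gt _ Fux).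
  apply: (@cvg_unique _ _ ((fun m => u m k.1 k.2) @ U)) => //.
    by move/cvg_mxP : ux; exact.
  by apply: cvg_near_cst.
have nr : r != - r by rewrite -subr_eq0 opprK gt_eqF // addr_gt0.
have sgn i j : F x i j * x i j <= 0.
  have [/= xh|/= Fh] := hi (i, j); have [/= xl|/= Fl] := lo (i, j).
  - by move: nr; rewrite -xl xh eqxx.
  - by rewrite xh mulr_le0_ge0 // ltW.
  - by rewrite xl mulr_ge0_le0 // oppr_le0 ltW.
  - by rewrite (_ : F x i j = 0) ?mul0r //; apply/eqP; rewrite eq_le Fl Fh.
exists x; have [xr'|xr'] := eqVneq `|x| r.
  have := Fpos x xr'; rewrite ltNge; case/negP.
  by apply: sumr_le0 => i _; apply: sumr_le0 => j _.
have xltr i j : `|x i j| < r.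
  by apply: le_lt_trans (mx_entry_le x i j) _; rewrite lt_neqAle xr'.
apply/matrixP => i j; rewrite mxE; apply/eqP; rewrite eq_le.
have := xltr i j.
have [/= xh|/= ->] := hi (i, j); first by rewrite xh gtr0_norm // ltxx.
have [/= xl|/= -> //] := lo (i, j).
by rewrite xl normrN gtr0_norm // ltxx.
Unshelve. all: by end_near. Qed.

End CoerciveZero.

(** * Discrete gradients *)

Section EpsDelta.
Context {R : realType} {V W : normedModType R}.

Lemma continuous_epsP (f : V -> W) (x : V) :
  {for x, continuous f} <->
  forall e : R, 0 < e -> exists2 d, 0 < d &
    forall y, `|x - y| < d -> `|f x - f y| < e.
Proof.
split=> [/cvgrPdist_lt cf e /cf|cf].
  by move/nbhs_normP => [d /= d0 Hd]; exists d.
apply/cvgrPdist_lt => e /cf [d d0 Hd].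
by apply/nbhs_normP; exists d.
Qed.

End EpsDelta.

Section Hadamard.
Context {R : realType} {n : nat}.
Implicit Types (f : 'rV[R]_n -> R) (c x y : 'rV[R]_n).

Lemma is_derive_partial f c i s : class_C1 f ->
  is_derive s (1 : R) (fun s : R => f (c + s *: delta_mx 0 i))
    (partial f i (c + s *: delta_mx 0 i)).
Proof.
move=> /(_ i) [df _]; have := df (c + s *: delta_mx 0 i).
have E : (fun h : R => h^-1 *: (((fun s : R => f (c + s *: delta_mx 0 i))
      \o shift s) (h *: (1 : R)) - f (c + s *: delta_mx 0 i))) =
    (fun h : R => h^-1 *: ((f \o shift (c + s *: delta_mx 0 i))
      (h *: delta_mx 0 i) - f (c + s *: delta_mx 0 i))).
  apply/funext => h /=; congr (_ *: (f _ - _)).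
  by rewrite scalerDl [h *: 1]mulr1 [LHS]addrCA.
by move=> d; split; rewrite /partial /derivable /derive E.
Qed.

Lemma mvt_partial f c i d : class_C1 f ->
  exists2 s : R, `|s| <= `|d| &
    f (c + d *: delta_mx 0 i) - f c = partial f i (c + s *: delta_mx 0 i) * d.
Proof.
move=> fC1; pose F (s : R) := f (c + s *: delta_mx 0 i).
have dF (s : R) : is_derive s (1 : R) F (partial f i (c + s *: delta_mx 0 i)).
  exact: is_derive_partial.
have cF (a b : R) : {within `[a, b], continuous F}.
  apply: continuous_subspaceT => s; apply: differentiable_continuous.
  by apply/derivable1_diffP; exact: ex_derive.
have F0 : F 0 = f c by rewrite /F scale0r addr0.
have [d0|d0] := leP 0 d.
  have [s + E] := MVT_segment d0 (fun s _ => dF s) (cF _ _).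
  rewrite in_itv /= => /andP[s0 sd].
  by exists s; rewrite ?ger0_norm // -F0 -/(F d) E subr0.
have [s + E] := MVT_segment (ltW d0) (fun s _ => dF s) (cF _ _).
rewrite in_itv /= => /andP[s0 sd].
exists s; first by rewrite ler0_norm // ltr0_norm // lerN2.
by rewrite -F0 -/(F d) -opprB E sub0r mulrN opprK.
Qed.

(** The path of [splice j x y], [j = 0, 1, ..., n], goes from [x] to [y]
    changing one coordinate at a time. *)
Definition splice (j : nat) x y : 'rV[R]_n :=
  \row_i (if (i < j)%N then y 0 i else x 0 i).

Lemma splice_step (j : 'I_n) x y :
  splice j.+1 x y = splice j x y + (y 0 j - x 0 j) *: delta_mx 0 j.
Proof.
apply/rowP => i; rewrite !mxE eqxx /= ltnS leq_eqVlt -[_ == _ :> nat]/(i == j).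
have [->|ij] /= := eqVneq i j; first by rewrite ltnn mulr1 addrC subrK.
by rewrite mulr0 addr0.
Qed.

Lemma splice_dist j x y x' y' :
  `|splice j x y - splice j x' y'| <= Num.max `|x - x'| `|y - y'|.
Proof.
apply/mx_norm_leP => [|a i]; first by rewrite le_max normr_ge0.
rewrite !mxE le_max; case: ifP => _; apply/orP; [right|left].
  by apply: le_trans (mx_entry_le (y - y') 0 i); rewrite !mxE.
by apply: le_trans (mx_entry_le (x - x') 0 i); rewrite !mxE.
Qed.

Lemma sum_splice f x y :
  f y - f x = \sum_(j < n) (f (splice j.+1 x y) - f (splice j x y)).
Proof.
rewrite -(big_mkord xpredT (fun j => f (splice j.+1 x y) - f (splice j x y))).
rewrite telescope_sumr //; congr (f _ - f _); apply/rowP => i; rewrite mxE //.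
by rewrite ltn_ord.
Qed.

Lemma norm_delta (s : R) (j : 'I_n) : `|s *: delta_mx 0 j : 'rV[R]_n| <= `|s|.
Proof.
apply/mx_norm_leP => // a i; rewrite !mxE; case: (_ && _).
  by rewrite mulr1.
by rewrite mulr0 normr0.
Qed.

Lemma splice_near x y (j : 'I_n) (s : R) : `|s| <= `|y 0 j - x 0 j| ->
  `|splice j x y + s *: delta_mx 0 j - x| <= `|y - x|.
Proof.
move=> sd; apply/mx_norm_leP => // a i; rewrite (ord1 a) !mxE eqxx /=.
have Hi : `|y 0 i - x 0 i| <= `|y - x|.
  by apply: le_trans (mx_entry_le (y - x) 0 i); rewrite !mxE.
have [ij|ij] := eqVneq i j.
  rewrite -ij in sd *; rewrite ltnn mulr1 addrC addKr.
  exact: le_trans sd Hi.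
by rewrite mulr0 addr0; case: ifP => // _; rewrite subrr normr0.
Qed.

Lemma class_C1_continuous f : class_C1 f -> continuous f.
Proof.
move=> fC1 x; pose K := \sum_(j < n) (`|partial f j x| + 1).
have K0 : 0 <= K by apply: sumr_ge0 => j _; rewrite addr_ge0.
have /choice [d Hd] : forall j : 'I_n, exists d : R, 0 < d /\ forall z : 'rV[R]_n,
    `|x - z| < d -> `|partial f j z| <= `|partial f j x| + 1.
  move=> j; have [_ /(_ x) /continuous_epsP /(_ 1 ltr01)[d d0 Hd]] := fC1 j.
  exists d; split=> // z /Hd; rewrite distrC => /ltW H.
  have := lerB_dist (partial f j z) (partial f j x).
  by rewrite lerBlDl => H1; apply: (le_trans H1); rewrite lerD2l.
apply/continuous_epsP => e e0; have e1 : 0 < e / (K + 1).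
  by rewrite divr_gt0 // ltr_wpDl.
pose m := \big[Num.min/e / (K + 1)]_(j < n) d j.
have m0 : 0 < m.
  by apply: (big_ind (fun z => 0 < z)) => // [z t z0 t0|j _]; rewrite ?lt_min ?z0 ?t0 //; case: (Hd j).
exists m => // y xy; rewrite distrC (sum_splice f x y).
apply: (@le_lt_trans _ _ (`|x - y| * K)).
  rewrite mulr_sumr.
  apply: le_trans (ler_norm_sum _ _ _) _; apply: ler_sum => j _.
  have [s sd E] := mvt_partial (splice j x y) j (y 0 j - x 0 j) fC1.
  rewrite splice_step E normrM mulrC distrC; apply: ler_pM => //.
    by apply: le_trans (mx_entry_le (x - y) 0 j); rewrite !mxE.
  case: (Hd j) => _; apply; rewrite distrC; apply: le_lt_trans (splice_near sd) _.
  rewrite distrC; apply: lt_le_trans xy _.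
  exact: bigmin_le_cond.
apply: (@le_lt_trans _ _ (m * K)); first by rewrite ler_wpM2r // ltW.
apply: (@lt_le_trans _ _ (m * (K + 1))); first by rewrite ltr_pM2l // ltrDl.
rewrite -ler_pdivlMr ?ltr_wpDl //; exact: bigmin_le_id.
Qed.

(** The discrete gradient of Itoh and Abe: slopes of [f] along the coordinate
    path from [x] to [y]. *)
Definition diffquot f x y : 'rV[R]_n :=
  \row_j (if y 0 j == x 0 j then partial f j (splice j x y)
    else (f (splice j.+1 x y) - f (splice j x y)) / (y 0 j - x 0 j)).

Lemma diffquot_inner f x y : f y - f x = inner (diffquot f x y) (y - x).
Proof.
rewrite (sum_splice f x y); apply: eq_bigr => j _; rewrite !mxE.
have [e|ne] := eqVneq; last by rewrite divfK // subr_eq0.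
by rewrite splice_step e !subrr scale0r addr0 subrr mulr0.
Qed.

Lemma splice_diag j x : splice j x x = x.
Proof. by apply/rowP => i; rewrite mxE if_same. Qed.

Lemma diffquot_diag f x : diffquot f x x = grad f x.
Proof. by apply/rowP => j; rewrite !mxE eqxx splice_diag. Qed.

Lemma splice_continuous j : continuous (fun z : 'rV[R]_n * 'rV[R]_n => splice j z.1 z.2).
Proof.
move=> [x y]; apply/continuous_epsP => e e0; exists e => // -[x' y'] /= H.
apply: le_lt_trans (splice_dist _ _ _ _ _) _.
by rewrite /Num.norm /= in H.
Qed.

(** Where the [j]-th coordinates of the two points agree, the quotient is a
    partial derivative at a nearby point by the mean value theorem, so
    continuity of the partial derivatives suffices. *)
Lemma diffquot_continuous f : class_C1 f ->
  continuous (fun z : 'rV[R]_n * 'rV[R]_n => diffquot f z.1 z.2).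
Proof.
move=> fC1 z0; rewrite -[z0]/(z0 : 'rV[R]_n * 'rV[R]_n).
suff H (j : 'I_n) (z1 : ('rV[R]_n * 'rV[R]_n)%type) :
    (fun z : 'rV[R]_n * 'rV[R]_n => diffquot f z.1 z.2 0 j) @ z1 -->
    diffquot f z1.1 z1.2 0 j.
  by apply/cvg_mxP => a j; rewrite (ord1 a); exact: H.
move: z1 => z0'.
have cdj : (fun z : 'rV[R]_n * 'rV[R]_n => z.2 0 j - z.1 0 j) @ z0' -->
    z0'.2 0 j - z0'.1 0 j.
  apply: cvgB; [apply: (@continuous_comp _ _ _ snd (fun M : 'rV[R]_n => M 0 j) z0')|
    apply: (@continuous_comp _ _ _ fst (fun M : 'rV[R]_n => M 0 j) z0')].
  - exact: cvg_snd.
  - exact: coord_continuous.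
  - exact: cvg_fst.
  - exact: coord_continuous.
have fmix k : (fun z : 'rV[R]_n * 'rV[R]_n => f (splice k z.1 z.2)) @ z0' -->
    f (splice k z0'.1 z0'.2).
  apply: (@continuous_comp _ _ _ (fun z : 'rV[R]_n * 'rV[R]_n => splice k z.1 z.2)
    f z0'); first exact: splice_continuous.
  exact: class_C1_continuous.
rewrite mxE; have [yx|yx] := eqVneq (z0'.2 0 j) (z0'.1 0 j); last first.
  have lim : (fun z : 'rV[R]_n * 'rV[R]_n =>
      (f (splice j.+1 z.1 z.2) - f (splice j z.1 z.2)) / (z.2 0 j - z.1 0 j)) @ z0'
      --> (f (splice j.+1 z0'.1 z0'.2) - f (splice j z0'.1 z0'.2)) / (z0'.2 0 j - z0'.1 0 j).
    apply: cvgM; first exact: cvgB.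
    by apply: cvgV => //; rewrite subr_eq0.
  apply: cvg_trans lim; apply: near_eq_cvg.
  have ne0 : \forall z \near z0',
      (z : 'rV[R]_n * 'rV[R]_n).2 0 j - (z : 'rV[R]_n * 'rV[R]_n).1 0 j != 0.
    by apply: (cvgr_neq0 _ cdj); rewrite subr_eq0.
  apply: filterS ne0 => z /=; rewrite subr_eq0 => /negPf ne0.
  by rewrite mxE ne0.
apply/cvgrPdist_lt => e e0.
have [_ /(_ (splice j z0'.1 z0'.2)) /cvgrPdist_lt /(_ e e0)] := fC1 j.
move=> /nbhs_normP[d /= d0 Hd].
have d2 : 0 < d / 2 by rewrite divr_gt0.
have /cvgrPdist_lt /(_ _ d2) H1 := @splice_continuous j z0'.
have /cvgrPdist_lt /(_ _ d2) := cdj; rewrite yx subrr.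
apply: filterS2 H1 => z /= H1; rewrite sub0r normrN => H2.
have [s sd ->] : exists2 s : R, `|s| <= `|z.2 0 j - z.1 0 j| &
    diffquot f z.1 z.2 0 j = partial f j (splice j z.1 z.2 + s *: delta_mx 0 j).
  have [zj|zj] := eqVneq (z.2 0 j) (z.1 0 j).
    by exists 0; rewrite ?normr0 // mxE zj eqxx scale0r addr0.
  have [s sd E] := mvt_partial (splice j z.1 z.2) j (z.2 0 j - z.1 0 j) fC1.
  exists s => //; rewrite mxE (negPf zj) splice_step E mulfK //.
  by rewrite subr_eq0.
apply: Hd; rewrite /= opprD addrA [d]splitr.
apply: le_lt_trans (ler_normB _ _) _; apply: ltrD => //.
exact: le_lt_trans (norm_delta _ _) (le_lt_trans sd H2).
Qed.

End Hadamard.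

(** * Derivatives on an interval *)

Section DerivativeOn.
Context {R : realType}.

Lemma derivative_onP n (a b : R) (f df : R -> 'rV[R]_n) :
  derivative_on a b f df <->
  forall t, t \in `[a, b] -> forall e : R, 0 < e -> exists2 d : R, 0 < d &
    forall s, s \in `[a, b] -> `|s - t| < d ->
      `|f s - f t - (s - t) *: df t| <= e * `|s - t|.
Proof.
have quot (s t e : R) : s != t ->
    (`|df t - (s - t)^-1 *: (f s - f t)| <= e) =
    (`|f s - f t - (s - t) *: df t| <= e * `|s - t|).
  move=> st; have st0 : s - t != 0 by rewrite subr_eq0.
  rewrite -ler_pdivrMr ?normr_gt0 // mulrC -normfV -normrZ.
  by rewrite [in RHS]scalerBr scalerA mulVf // scale1r distrC.
split=> D t tab.
  move=> e e0; have /cvgrPdist_le /(_ e e0) := D t tab.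
  rewrite /within /= => /nbhs_normP[d /= d0 Hd]; exists d => // s sab st.
  have [->|ts] := eqVneq s t; first by rewrite !subrr scale0r subr0 !normr0 mulr0.
  by rewrite -quot //; apply: Hd => //=; rewrite distrC.
apply/cvgrPdist_le => e e0; have [d d0 Hd] := D t tab e e0.
rewrite /within /=; apply/nbhs_normP; exists d => //= s st ts sab.
by rewrite quot //; apply: Hd => //; rewrite distrC.
Qed.

Lemma derivative_on_continuous n (a b : R) (f df : R -> 'rV[R]_n) :
  derivative_on a b f df -> {within `[a, b], continuous f}.
Proof.
move=> /derivative_onP D; apply/subspace_continuousP => t tab.
apply/cvgrPdist_lt => e e0; have [d d0 Hd] := D t tab 1 ltr01.
pose K := `|df t| + 1; have K0 : 0 < K by rewrite ltr_wpDl.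
rewrite /within /=; apply/nbhs_normP; exists (Num.min d (e / K)) => /=.
  by rewrite lt_min d0 divr_gt0.
move=> s; rewrite /= lt_min => /andP[]; rewrite distrC => sd se sab.
rewrite distrC -[f s - f t](subrK ((s - t) *: df t)).
apply: le_lt_trans (ler_normD _ _) _.
apply: (@le_lt_trans _ _ (1 * `|s - t| + `|s - t| * `|df t|)).
  by apply: lerD; [exact: Hd|rewrite normrZ].
have : `|s - t| * K < e by rewrite -ltr_pdivlMr.
by rewrite /K mulrDr mulr1 addrC mul1r.
Qed.

Lemma derivative_onD n (a b : R) (f df g dg : R -> 'rV[R]_n) :
  derivative_on a b f df -> derivative_on a b g dg ->
  derivative_on a b (fun t => f t + g t) (fun t => df t + dg t).
Proof.
move=> /derivative_onP Df /derivative_onP Dg; apply/derivative_onP => t tab e e0.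
have e2 : 0 < e / 2 by rewrite divr_gt0.
have [d1 d10 H1] := Df t tab _ e2; have [d2 d20 H2] := Dg t tab _ e2.
exists (Num.min d1 d2) => [|s sab]; first by rewrite lt_min d10.
rewrite lt_min => /andP[s1 s2]; rewrite [e]splitr mulrDl.
have -> : f s + g s - (f t + g t) - (s - t) *: (df t + dg t) =
    (f s - f t - (s - t) *: df t) + (g s - g t - (s - t) *: dg t).
  rewrite scalerDr !opprD (addrACA (f s)).
  exact: addrACA.
apply: le_trans (ler_normD _ _) _.
by apply: lerD; [exact: H1|exact: H2].
Qed.

Lemma derivable_epsP (F : R -> R) (t f : R) :
  derivable F t 1 -> derive1 F t = f -> forall e : R, 0 < e ->
  exists2 d : R, 0 < d &
    forall s, `|s - t| < d -> `|F s - F t - (s - t) * f| <= e * `|s - t|.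
Proof.
move=> dF fE e e0.
have : h^-1 *: ((F \o shift t) (h *: (1 : R)) - F t) @[h --> 0^'] --> f.
  by rewrite -fE derive1E; exact: dF.
move/cvgrPdist_le => /(_ e e0).
rewrite /dnbhs /within /= => /nbhs_normP[d /= d0 Hd]; exists d => // s st.
have [->|ts] := eqVneq s t; first by rewrite !subrr mul0r subr0 !normr0 mulr0.
have st0 : s - t != 0 by rewrite subr_eq0.
have := Hd (s - t); rewrite /= sub0r normrN => /(_ st st0).
rewrite [_ *: 1]mulr1 subrK.
rewrite -[(s - t)^-1 *: _]/((s - t)^-1 * _) => H.
rewrite -ler_pdivrMr ?normr_gt0 // -normfV -normrM mulrBl.
by rewrite (mulrC (s - t)) mulfK // distrC mulrC.
Qed.

(** Extending [f] by its end values turns one-sided statements at the ends of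
    the interval into two-sided ones, to which the fundamental theorem of
    calculus applies. *)
Lemma clamp_continuous_extension (T : R) (f : R -> R) : 0 < T ->
  {within `[0, T], continuous f} ->
  continuous (fun s => f (Num.max 0 (Num.min s T))).
Proof.
move=> T0 /subspace_continuousP cf s; set c := fun s : R => Num.max 0 (Num.min s T).
have cin u : `[0, T]%classic (c u).
  rewrite /= in_itv /= /c le_max lexx /= ge_max ltW //= ge_min lexx orbT //.
apply: (cvg_comp c f _ (cf _ (cin s))).
have cLip u : `|c s - c u| <= `|s - u|.
  have h1 := ler_norm (s - u); have := ler_norm (u - s); rewrite distrC => h2.
  rewrite ler_norml /c; case: (leP s T) => ?; case: (leP u T) => ?;
    rewrite ?(max_r (ltW T0)); case: (leP 0 s) => ?; case: (leP 0 u) => ?;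
    by apply/andP; split; lra.
move=> A; rewrite /within /= => /nbhs_normP[d /= d0 Hd].
apply/nbhs_normP; exists d => // u su; apply: Hd; last exact: cin.
exact: le_lt_trans (cLip u) su.
Qed.

Local Notation mu := (@lebesgue_measure R).

Lemma scalar_primitive (T : R) (f : R -> R) : 0 < T ->
  {within `[0, T], continuous f} -> exists F : R -> R,
  [/\ forall t, t \in `[0, T] -> forall e : R, 0 < e ->
        exists2 d : R, 0 < d &
        forall s, `|s - t| < d -> `|F s - F t - (s - t) * f t| <= e * `|s - t|
    & F T - F 0 = \int[mu]_(t in `[0, T]) f t].
Proof.
move=> T0 cf; pose g s := f (Num.max 0 (Num.min s T)).
have gf t : t \in `[0, T] -> g t = f t.
  rewrite in_itv /= => /andP[t0 tT]; rewrite /g; congr f.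
  by rewrite min_l // max_r.
have cg : continuous g by exact: clamp_continuous_extension.
have ig : mu.-integrable `[-1, T + 1] (EFin \o g).
  apply: continuous_compact_integrable; first exact: segment_compact.
  exact: continuous_subspaceT.
pose F x := \int[mu]_(t in `[-1, x]) g t.
have dF t : t \in `[0, T] -> derivable F t 1 /\ derive1 F t = g t.
  rewrite in_itv /= => /andP[t0 tT].
  apply: (@continuous_FTC1_closed _ g (-1) t (T + 1)) => //.
  - by rewrite (le_lt_trans tT) // ltrDl.
  - by rewrite (lt_le_trans _ t0) // ltrN10.
  - exact: cg.
have cF t : t \in `[0, T] -> {for t, continuous F}.
  move=> /dF[/derivable1_diffP dFt _]; exact: differentiable_continuous.
have t0T : 0 \in `[0, T] by rewrite in_itv /= lexx ltW.
have tTT : T \in `[0, T] by rewrite in_itv /= lexx ltW.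
have oc t : t \in `]0, T[ -> t \in `[0, T] by exact: subset_itv_oo_cc.
exists F; split.
  move=> t tT e e0; have [d1 d2] := dF t tT.
  by apply: derivable_epsP => //; rewrite d2 gf.
rewrite /Rintegral (@continuous_FTC2 _ f F 0 T) //=.
  split; first by move=> t /oc /dF[].
  - by apply: cvg_at_right_filter; exact: cF.
  - by apply: cvg_at_left_filter; exact: cF.
by move=> t /oc tT; have [_ ->] := dF t tT; exact: gf.
Qed.

Lemma primitive_exists n (T : R) (p : R -> 'rV[R]_n) : 0 < T ->
  {within `[0, T], continuous p} ->
  (forall i, \int[mu]_(t in `[0, T]) (p t 0 i) = 0) ->
  exists2 P : R -> 'rV[R]_n, derivative_on 0 T P p & P 0 = P T.
Proof.
move=> T0 cp ip.
have H (i : 'I_n) : exists F : R -> R,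
  [/\ forall t, t \in `[0, T] -> forall e : R, 0 < e ->
        exists2 d : R, 0 < d &
        forall s, `|s - t| < d -> `|F s - F t - (s - t) * p t 0 i| <= e * `|s - t|
    & F T - F 0 = \int[mu]_(t in `[0, T]) p t 0 i].
  apply: scalar_primitive => //; apply/subspace_continuousP => t tT.
  move/subspace_continuousP : cp => /(_ t tT) /cvg_mxP; exact.
have [F HF] := choice H.
exists (fun t => \row_i F i t); last first.
  apply/rowP => i; rewrite !mxE; have [_ E] := HF i.
  by apply/esym/eqP; rewrite -subr_eq0 E ip.
apply/derivative_onP => t tT e e0.
have H2 (i : 'I_n) : exists d : R, 0 < d /\ forall s, `|s - t| < d ->
    `|F i s - F i t - (s - t) * p t 0 i| <= e * `|s - t|.
  by have [D _] := HF i; have [d d0 Hd] := D t tT e e0; exists d.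
have [d Hd] := choice H2.
exists (\big[Num.min/1]_(j < n) d j).
  by apply: (big_ind (fun z => 0 < z)) => // [z u z0 u0|j _];
    [rewrite lt_min z0 u0|case: (Hd j)].
move=> s sT st; apply/mx_norm_leP => [|a i]; first by rewrite mulr_ge0 // ltW.
rewrite (ord1 a) !mxE; have [_] := Hd i; apply.
by apply: lt_le_trans st _; exact: bigmin_le_cond.
Qed.

(** A chain rule that needs no differential: a discrete gradient of each
    component of [f], taken between [x t] and [x s], writes the difference
    quotient of [f \o x] as an inner product whose two factors converge. *)
Lemma derivative_on_comp n (a b : R) (f : 'rV[R]_n -> 'rV[R]_n)
    (g : 'I_n -> 'rV[R]_n -> 'rV[R]_n -> 'rV[R]_n) (x dx : R -> 'rV[R]_n) :
  (forall i, continuous (fun z : 'rV[R]_n * 'rV[R]_n => g i z.1 z.2)) ->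
  (forall i u v, f v 0 i - f u 0 i = inner (g i u v) (v - u)) ->
  derivative_on a b x dx ->
  derivative_on a b (f \o x) (fun t => \row_i inner (g i (x t) (x t)) (dx t)).
Proof.
move=> cg fg Dx t tab; apply/cvg_mxP => k i; rewrite (ord1 k) {k}.
have cx := derivative_on_continuous Dx.
move/subspace_continuousP : cx => /(_ t tab) cx.
have xx : x @ within `[a, b] t^' --> x t.
  apply: cvg_trans cx; apply: cvg_fmap2 => A; rewrite /dnbhs /within /=.
  by apply: (@filterS _ (nbhs t) _) => s H _; exact: H.
have cgx : (fun s => g i (x t) (x s)) @ within `[a, b] t^' --> g i (x t) (x t).
  apply: (@continuous2_cvg _ _ _ _ _ _ (fun=> x t) x (g i) (x t) (x t)) => //.
    exact: (cg i (x t, x t)).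
  exact: cvg_cst.
have -> : (fun s => ((s - t)^-1 *: ((f \o x) s - (f \o x) t)) 0 i) =
    (fun s => \sum_(j < n) g i (x t) (x s) 0 j * ((s - t)^-1 *: (x s - x t)) 0 j).
  apply/funext => s; rewrite !mxE /= fg /inner mulr_sumr.
  by apply: eq_bigr => j _; rewrite !mxE mulrCA.
rewrite mxE; apply: cvg_big => [|j _]; first exact: add_continuous.
apply: cvgM; first by move/cvg_mxP : cgx; exact.
by have /cvg_mxP := Dx t tab; exact.
Qed.

End DerivativeOn.

(** * Continuity and compactness *)

Section LimitsAndCompactness.
Context {R : realType}.

Lemma cvg_continuous2 {S : Type} {U V W : topologicalType} {L : set_system S}
    {FL : Filter L} (g : U -> V -> W) (u : S -> U) (v : S -> V) a b :
  continuous (fun z : U * V => g z.1 z.2) ->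
  u @ L --> a -> v @ L --> b -> (fun s => g (u s) (v s)) @ L --> g a b.
Proof.
move=> cg ua vb; apply: (@continuous2_cvg _ _ _ _ _ _ u v g a b) => //.
exact: (cg (a, b)).
Qed.

Lemma within_cvg {V W : topologicalType} {S : Type} {L : set_system S}
    {FL : Filter L} (D : set V) (f : V -> W) (u : S -> V) (z : V) :
  {within D, continuous f} -> D z -> u @ L --> z ->
  (\forall s \near L, D (u s)) -> (fun s => f (u s)) @ L --> f z.
Proof.
move=> /subspace_continuousP cf Dz uz Du A fA.
have /= wA := cf z Dz A fA; rewrite /within /= in wA.
by apply: filterS2 Du (uz _ wA) => s Ds; exact.
Qed.

Lemma compact_image_bounded {V : topologicalType} n (K : set V)
    (f : V -> 'rV[R]_n) :
  compact K -> {within K, continuous f} ->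
  exists C : R, forall x, K x -> `|f x| <= C.
Proof.
move=> cK cf; have := compact_bounded (continuous_compact cf cK).
move=> [M [_ HM]]; exists (M + 1) => x Kx.
by apply: (HM (M + 1)); [rewrite ltrDl|exists x].
Qed.

Lemma closed_ball_compact n (B : R) : compact [set x : 'rV[R]_n | `|x| <= B].
Proof.
apply: bounded_closed_compact.
  by exists B; split => [|M BM x /= xB]; [exact: num_real|exact: le_trans xB (ltW BM)].
by apply: (closed_comp _ (@closed_le _ B)) => z _; exact: norm_continuous.
Qed.

Lemma bounded_on_ball n (f : 'rV[R]_n -> 'rV[R]_n) (B : R) : continuous f ->
  exists C : R, forall x, `|x| <= B -> `|f x| <= C.
Proof.
move=> cf; apply: (compact_image_bounded (@closed_ball_compact n B)).
exact: continuous_subspaceT.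
Qed.

Lemma bounded_on_ball2 n (f : 'rV[R]_n -> 'rV[R]_n -> 'rV[R]_n) (B : R) :
  continuous (fun z : 'rV[R]_n * 'rV[R]_n => f z.1 z.2) ->
  exists C : R, forall x y, `|x| <= B -> `|y| <= B -> `|f x y| <= C.
Proof.
move=> cf.
have [C HC] : exists C : R, forall z,
    ([set x : 'rV[R]_n | `|x| <= B] `*` [set x : 'rV[R]_n | `|x| <= B]) z ->
    `|f z.1 z.2| <= C.
  apply: compact_image_bounded; last exact: continuous_subspaceT.
  by apply: compact_setX; exact: closed_ball_compact.
by exists C => x y xB yB; apply: (HC (x, y)).
Qed.

End LimitsAndCompactness.

(** * The Euclidean structure and the sup norm *)

Section Inner.
Context {R : realType} {n : nat}.
Implicit Types u v w : 'rV[R]_n.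

Lemma innerC u v : inner u v = inner v u.
Proof. by apply: eq_bigr => i _; rewrite mulrC. Qed.

Lemma innerDl u v w : inner (u + v) w = inner u w + inner v w.
Proof. by rewrite -big_split; apply: eq_bigr => i _; rewrite mxE mulrDl. Qed.

Lemma innerZl a u w : inner (a *: u) w = a * inner u w.
Proof. by rewrite mulr_sumr; apply: eq_bigr => i _; rewrite mxE mulrA. Qed.

Lemma innerNl u w : inner (- u) w = - inner u w.
Proof. by rewrite -scaleN1r innerZl mulN1r. Qed.

Lemma innerBl u v w : inner (u - v) w = inner u w - inner v w.
Proof. by rewrite innerDl innerNl. Qed.

Lemma innerBr u v w : inner w (u - v) = inner w u - inner w v.
Proof. by rewrite ![inner w _]innerC innerBl. Qed.

Lemma innerZr a u w : inner w (a *: u) = a * inner w u.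
Proof. by rewrite ![inner w _]innerC innerZl. Qed.

Lemma inner_ge0 u : 0 <= inner u u.
Proof. by apply: sumr_ge0 => i _; exact: sqr_ge0. Qed.

Lemma sqr_entry_le u i : (u 0 i) ^+ 2 <= inner u u.
Proof.
rewrite /inner (bigD1 i) //= -expr2 lerDl; apply: sumr_ge0 => j _.
exact: sqr_ge0.
Qed.

Lemma enorm_ge0 u : 0 <= enorm u.
Proof. exact: sqrtr_ge0. Qed.

Lemma norm_le_enorm u : `|u| <= enorm u.
Proof.
apply/mx_norm_leP => [|a i]; first exact: enorm_ge0.
by rewrite (ord1 a) -sqrtr_sqr ler_wsqrtr // sqr_entry_le.
Qed.

Lemma abs_inner_le u v : `|inner u v| <= n%:R * (`|u| * `|v|).
Proof.
apply: le_trans (ler_norm_sum _ _ _) _.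
apply: (@le_trans _ _ (\sum_(i < n) `|u| * `|v|)).
  by apply: ler_sum => i _; rewrite normrM; apply: ler_pM => //; exact: mx_entry_le.
by rewrite sumr_const card_ord mulr_natl.
Qed.

Lemma enorm_le_norm u : enorm u <= n%:R * `|u|.
Proof.
have n0 : 0 <= n%:R * `|u| by rewrite mulr_ge0.
rewrite -(ger0_norm n0) -sqrtr_sqr ler_wsqrtr //.
apply: le_trans (ler_norm _) _; apply: le_trans (abs_inner_le _ _) _.
rewrite exprMn -expr2 ler_wpM2r ?sqr_ge0 //.
by rewrite -natrX ler_nat -mulnn; case: (n) => // k; exact: leq_pmulr.
Qed.

End Inner.

(** * The discrete problem *)

Section DiscreteProblem.
Context {R : realType} {n : nat}.
Variables (T : R) (phi : 'rV[R]_n -> 'rV[R]_n) (G : 'rV[R]_n -> R).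
Variables (g : 'rV[R]_n -> 'rV[R]_n -> 'rV[R]_n).
Variables (h : R -> 'rV[R]_n -> 'rV[R]_n) (P : R -> 'rV[R]_n).
Hypothesis T_gt0 : 0 < T.
Hypothesis gG : forall u v, G v - G u = inner (g u v) (v - u).

Definition grid (N k : nat) : R := k%:R * T / N%:R.

Definition slope (N : nat) (X : nat -> 'rV[R]_n) (k : nat) : 'rV[R]_n :=
  (N%:R / T) *: (X k.+1 - X k).

(** [W] is the discrete phi (x') - grad G (x) - P.  The forcing is
    sampled at the left end of each step in time, so that the last step of the
    period does not wrap around to time 0; and at the right end in space, so
    that summation by parts produces the slopes of [X]. *)
Definition discrete_solution (N : nat) (eps : R) (X W : nat -> 'rV[R]_n) :=
  [/\ X N = X 0%N, W N = W 0%N,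
   forall k, (k < N)%N ->
     W k = phi (slope N X k) - g (X k) (X k.+1) - P (grid N k)
   & forall k, (k < N)%N ->
     W k.+1 - W k = (T / N%:R) *: (h (grid N k) (X k.+1) + eps *: X k.+1)].

Variables (M K0 BP : R).
Hypothesis M_gt0 : 0 < M.
Hypothesis K0_gt0 : 0 < K0.
Hypothesis phi_coer : forall xi,
  (n%:R * BP + 1) * enorm xi - M <= inner (phi xi) xi.
Hypothesis P_le : forall t, t \in `[0, T] -> `|P t| <= BP.
Hypothesis h_ge : forall t x, t \in `[0, T] -> - K0 <= inner (h t x) x.

Lemma grid_in N k : (k <= N)%N -> (0 < N)%N -> grid N k \in `[0, T].
Proof.
move=> kN N0; rewrite in_itv /= /grid; apply/andP; split.
  by rewrite divr_ge0 ?mulr_ge0 ?ler0n // ltW.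
by rewrite ler_pdivrMr ?ltr0n // mulrC ler_pM2l // ler_nat.
Qed.

Lemma summation_by_parts N (X W : nat -> 'rV[R]_n) :
  X N = X 0%N -> W N = W 0%N ->
  \sum_(0 <= k < N) inner (W k - W k.+1) (X k.+1) =
  \sum_(0 <= k < N) inner (W k) (X k.+1 - X k).
Proof.
move=> XN WN; apply/eqP; rewrite -subr_eq0 -sumrB.
rewrite (eq_bigr (fun k => - (inner (W k.+1) (X k.+1) - inner (W k) (X k)))).
  by rewrite sumrN telescope_sumr // XN WN subrr oppr0.
by move=> k _; rewrite innerBl innerBr; ring.
Qed.

(** Summation by parts leaves the pairings of [W] with the slopes; there [G]
    telescopes, and the extra slope [n * BP] in the coercivity of [phi] absorbs
    the term in [P]. *)
Lemma energy_ge N (X W : nat -> 'rV[R]_n) : (0 < N)%N ->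
  X N = X 0%N -> W N = W 0%N ->
  (forall k, (k < N)%N ->
     W k = phi (slope N X k) - g (X k) (X k.+1) - P (grid N k)) ->
  T / N%:R * (\sum_(0 <= k < N) enorm (slope N X k)) - T * M <=
  \sum_(0 <= k < N) inner (W k - W k.+1) (X k.+1).
Proof.
move=> N0 XN WN WE; rewrite summation_by_parts //.
have NR0 : 0 < N%:R :> R by rewrite ltr0n.
have dX k : X k.+1 - X k = (T / N%:R) *: slope N X k.
  by rewrite scalerA mulrA divfK ?gt_eqF // divff ?gt_eqF // scale1r.
apply: (@le_trans _ _ (\sum_(0 <= k < N)
    ((T / N%:R) * (enorm (slope N X k) - M) - (G (X k.+1) - G (X k))))).
  rewrite sumrB telescope_sumr // XN subrr subr0 -mulr_sumr sumrB mulrBr.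
  rewrite sumr_const_nat subn0 -[M *+ N]mulr_natr.
  have -> // : T / N%:R * (M * N%:R) = T * M by field; rewrite gt_eqF.
rewrite big_nat [leRHS]big_nat; apply: ler_sum => k /andP[_ kN].
rewrite WE // !innerBl gG; set q := inner (g _ _) _.
rewrite dX !(innerZr (T / N%:R) (slope N X k)) [leRHS]addrAC lerB // -mulrBr ler_pM2l ?divr_gt0 //.
have := phi_coer (slope N X k); set y := slope N X k; move=> Hy.
have Hp : inner (P (grid N k)) y <= n%:R * BP * enorm y.
  apply: le_trans (ler_norm _) _; apply: le_trans (abs_inner_le _ _) _.
  rewrite -mulrA ler_wpM2l ?ler0n //; apply: ler_pM => //.
    by apply: P_le; apply: grid_in => //; exact: ltnW.
  exact: norm_le_enorm.
by rewrite mulrDl mul1r in Hy; lra.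
Qed.

Hypothesis phi_cont : continuous phi.
Hypothesis g_cont : continuous (fun z : 'rV[R]_n * 'rV[R]_n => g z.1 z.2).
Hypothesis h_contx : forall t, t \in `[0, T] -> continuous (h t).

Lemma sqr_mx_norm_le a b (A : 'M[R]_(a, b)) :
  `|A| ^+ 2 <= \sum_i \sum_j A i j ^+ 2.
Proof.
set S := \sum_i _; have S0 : 0 <= S.
  by apply: sumr_ge0 => i _; apply: sumr_ge0 => j _; exact: sqr_ge0.
rewrite -(sqr_sqrtr S0) ler_pXn2r ?nnegrE ?sqrtr_ge0 //.
apply/mx_norm_leP => [|i j]; first exact: sqrtr_ge0.
rewrite -sqrtr_sqr ler_wsqrtr // /S (bigD1 i) //= (bigD1 j) //= -addrA lerDl.
rewrite addr_ge0 //.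
  by apply: sumr_ge0 => j' _; exact: sqr_ge0.
by apply: sumr_ge0 => i' _; apply: sumr_ge0 => j' _; exact: sqr_ge0.
Qed.

(** The unknown is the matrix whose row [i] is [X i.+1]; this is why the rows are
    read with a shift.  Its squared norm is controlled by the [eps] term, which
    beats the constants of [energy_ge] on a large sphere. *)
Lemma discrete_solution_exists N eps : (0 < N)%N -> 0 < eps ->
  exists X W, discrete_solution N eps X W.
Proof.
case: N => // m _ eps0; set N := m.+1.
have NR0 : 0 < N%:R :> R by rewrite ltr0n.
pose X (A : 'M[R]_(N, n)) k : 'rV[R]_n := row (inord ((k + m) %% N)) A.
pose W A k : 'rV[R]_n := phi (slope N (X A) k) - g (X A k) (X A k.+1)
   - P (grid N (k %% N)).
pose F A k : 'rV[R]_n := (T / N%:R) *: (h (grid N k) (X A k.+1) + eps *: X A k.+1)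
   - (W A k.+1 - W A k).
have XS A (i : 'I_N) : X A i.+1 = row i A.
  rewrite /X; congr (row _ A); apply/val_inj => /=.
  rewrite addSnnS modnDr modn_small ?ltn_ord // inordK //.
have XN A k : X A (k + N)%N = X A k by rewrite /X addnAC modnDr.
have WN A k : W A (k + N)%N = W A k.
  by rewrite /W /slope -addSn !XN modnDr.
have sol A : (forall k : 'I_N, F A k = 0) -> discrete_solution N eps (X A) (W A).
  move=> FA; split.
  - exact: (XN A 0%N).
  - exact: (WN A 0%N).
  - by move=> k kN; rewrite /W modn_small.
  - move=> k kN; apply/eqP; rewrite eq_sym -subr_eq0; apply/eqP.
    exact: (FA (Ordinal kN)).
have tin (k : 'I_N) : grid N k \in `[0, T] by apply: grid_in => //; exact: ltnW.
have cX (L : set_system 'M[R]_(N, n)) (FL : Filter L) A k :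
    L --> A -> X^~ k @ L --> X A k.
  move=> LA; apply/cvg_mxP => i j; rewrite /X mxE.
  have /cvg_mxP /(_ (inord ((k + m) %% N)) j) : id @ L --> A by [].
  have -> // : (fun B : 'M[R]_(N, n) => row (inord ((k + m) %% N)) B i j) =
      (fun B => B (inord ((k + m) %% N)) j).
  by apply/funext => B; rewrite mxE.
have cW (L : set_system 'M[R]_(N, n)) (FL : Filter L) A k :
    L --> A -> W^~ k @ L --> W A k.
  move=> LA; have cXk l := cX L FL A l LA.
  rewrite /W; apply: cvgB; last exact: cvg_cst.
  apply: cvgB.
    apply: (@cvg_comp _ _ _ (fun A => slope N (X A) k) phi L); last exact: phi_cont.
    by apply: cvgZ; [exact: cvg_cst|apply: cvgB; exact: cXk].
  by apply: cvg_continuous2; [exact: g_cont|exact: cXk|exact: cXk].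
have cF (L : set_system 'M[R]_(N, n)) (FL : Filter L) A (k : 'I_N) :
    L --> A -> F^~ (k : nat) @ L --> F A k.
  move=> LA; have cXk l := cX L FL A l LA; have cWk l := cW L FL A l LA.
  rewrite /F; apply: cvgB; last by apply: cvgB; exact: cWk.
  apply: cvgZ; first exact: cvg_cst.
  apply: cvgD; last by apply: cvgZ; [exact: cvg_cst|exact: cXk].
  apply: (@cvg_comp _ _ _ (fun A => X A k.+1) (h (grid N k)) L).
    exact: cXk.
  by apply: h_contx; exact: tin.
(* The field points outwards where the squared norm exceeds [Q], and
   [(1 + Q) ^+ 2 > Q]. *)
pose Q := T * (M + K0) / (T / N%:R * eps).
have Q0 : 0 < Q by rewrite !(mulr_gt0, invr_gt0, addr_gt0).
have [|||A FA] := @coercive_zero R N n (fun A => \matrix_(i < N, j < n) F A i 0 j) (1 + Q).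
- by rewrite addr_gt0.
- suff cFA (L : set_system 'M[R]_(N, n)) (FL : Filter L) A : L --> A ->
      (fun A => \matrix_(i < N, j < n) F A i 0 j) @ L --> \matrix_(i < N, j < n) F A i 0 j.
    by move=> A; apply: (cFA _ (nbhs_filter (A : 'M[R]_(N, n)))); exact: cvg_id.
  move=> LA; apply/cvg_mxP => i j; rewrite mxE.
  have -> : (fun A => (\matrix_(i < N, j < n) F A i 0 j) i j) = (fun A => F A i 0 j).
    by apply/funext => B; rewrite mxE.
  by have /cvg_mxP := cF L FL A i LA; exact.
- move=> A Ar.
  have -> : \sum_i \sum_j (\matrix_(i < N, j < n) F A i 0 j) i j * A i j =
      \sum_(0 <= k < N) inner (F A k) (X A k.+1).
    rewrite big_mkord; apply: eq_bigr => i _; apply: eq_bigr => j _.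
    by rewrite XS [X in X * _ = _]mxE [X in _ = _ * X]mxE.
  have En : T / N%:R * (\sum_(0 <= k < N) enorm (slope N (X A) k)) - T * M <=
      \sum_(0 <= k < N) inner (W A k - W A k.+1) (X A k.+1).
    apply: energy_ge => //; [exact: (XN A 0%N)|exact: (WN A 0%N)|].
    by move=> k kN; rewrite /W modn_small.
  have S1 : 0 <= T / N%:R * (\sum_(0 <= k < N) enorm (slope N (X A) k)).
    apply: mulr_ge0; first by rewrite divr_ge0 // ltW.
    by apply: sumr_ge0 => k _; exact: enorm_ge0.
  have Hh : T / N%:R * (\sum_(0 <= k < N) - K0) + T / N%:R * eps * (1 + Q) ^+ 2 <=
     \sum_(0 <= k < N) inner ((T / N%:R) *: (h (grid N k) (X A k.+1) + eps *: X A k.+1)) (X A k.+1).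
    apply: (@le_trans _ _ (T / N%:R * (\sum_(0 <= k < N) - K0) +
       T / N%:R * eps * (\sum_(0 <= k < N) inner (X A k.+1) (X A k.+1)))).
      rewrite lerD2l; apply: ler_wpM2l.
        by apply: mulr_ge0; rewrite ?divr_ge0 // ltW.
      rewrite -Ar; apply: le_trans (sqr_mx_norm_le _) _.
      rewrite big_mkord; apply: ler_sum => i _; apply: ler_sum => j _.
      by rewrite XS [X in _ <= X * X]mxE expr2.
    set tau := T / N%:R; rewrite -mulrA -mulrDr [in X in _ * (_ + X)]mulr_sumr -big_split /= mulr_sumr.
    apply: ler_sum_nat => k /andP[_ kN].
    rewrite innerZl; apply: ler_wpM2l; first by rewrite /tau divr_ge0 // ltW.
    rewrite innerDl innerZl lerD2r.
    exact: (h_ge _ (tin (Ordinal kN))).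
  have SK : T / N%:R * (\sum_(0 <= k < N) - K0) = - (T * K0).
    rewrite sumr_const_nat subn0 -[- K0 *+ N]mulr_natr.
    by field; rewrite gt_eqF.
  have HQ : T * (M + K0) < T / N%:R * eps * (1 + Q) ^+ 2.
    rewrite [ltRHS]mulrC -ltr_pdivrMr ?mulr_gt0 ?invr_gt0 // -/Q.
    by rewrite expr2; nra.
  have -> : \sum_(0 <= k < N) inner (F A k) (X A k.+1) =
    \sum_(0 <= k < N) inner (W A k - W A k.+1) (X A k.+1) +
    \sum_(0 <= k < N) inner ((T / N%:R) *: (h (grid N k) (X A k.+1) + eps *: X A k.+1)) (X A k.+1).
    rewrite -big_split; apply: eq_bigr => k _ /=.
    by rewrite /F innerBl !innerBl; ring.
  rewrite SK in Hh; lra.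
exists (X A), (W A); apply: sol => k; apply/rowP => j.
by move/matrixP : FA => /(_ k j); rewrite !mxE.
Qed.

End DiscreteProblem.

(** * Bounds independent of the mesh *)

Section APriori.
Context {R : realType} {n : nat}.
Variables (T : R) (phi : 'rV[R]_n -> 'rV[R]_n) (G : 'rV[R]_n -> R).
Variables (g : 'rV[R]_n -> 'rV[R]_n -> 'rV[R]_n).
Variables (h : R -> 'rV[R]_n -> 'rV[R]_n) (P : R -> 'rV[R]_n).
Hypothesis T_gt0 : 0 < T.
Hypothesis gG : forall u v, G v - G u = inner (g u v) (v - u).
Variables (M K0 BP : R).
Hypothesis M_gt0 : 0 < M.
Hypothesis K0_gt0 : 0 < K0.
Hypothesis phi_coer : forall xi,
  (n%:R * BP + 1) * enorm xi - M <= inner (phi xi) xi.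
Hypothesis P_le : forall t, t \in `[0, T] -> `|P t| <= BP.
Hypothesis h_ge : forall t x, t \in `[0, T] -> - K0 <= inner (h t x) x.

Definition osc_bound : R := T * (M + K0).

Lemma osc_bound_gt0 : 0 < osc_bound.
Proof. by rewrite mulr_gt0 // addr_gt0. Qed.

Local Notation solution := (discrete_solution T phi g h P).

Section OneSolution.
Variables (N : nat) (eps : R) (X W : nat -> 'rV[R]_n).
Hypothesis N_gt0 : (0 < N)%N.
Hypothesis eps_gt0 : 0 < eps.
Hypothesis sol : solution N eps X W.

Let NR0 : 0 < N%:R :> R. Proof. by rewrite ltr0n. Qed.
Let tau_gt0 : 0 < T / N%:R. Proof. by rewrite divr_gt0. Qed.

Lemma discrete_energy :
  T / N%:R * (\sum_(0 <= k < N) enorm (slope T N X k)) +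
  T / N%:R * (\sum_(0 <= k < N) inner (h (grid T N k) (X k.+1)) (X k.+1))
  <= T * M.
Proof.
have [XN WN WE WS] := sol.
have := energy_ge T_gt0 gG phi_coer P_le N_gt0 XN WN WE.
have -> : \sum_(0 <= k < N) inner (W k - W k.+1) (X k.+1) =
    - (T / N%:R * (\sum_(0 <= k < N) inner (h (grid T N k) (X k.+1)) (X k.+1))) -
    T / N%:R * eps * (\sum_(0 <= k < N) inner (X k.+1) (X k.+1)).
  rewrite -opprD; set tau := T / N%:R.
  rewrite -mulrA -mulrDr [in X in _ * (_ + X)]mulr_sumr -big_split /= mulr_sumr.
  rewrite -sumrN; apply: eq_big_nat => k /andP[_ kN].
  by rewrite -opprB innerNl WS // innerZl innerDl innerZl.
have : 0 <= T / N%:R * eps * (\sum_(0 <= k < N) inner (X k.+1) (X k.+1)).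
  apply: mulr_ge0; first by rewrite mulr_ge0 // ltW.
  by apply: sumr_ge0 => k _; exact: inner_ge0.
lra.
Qed.

Lemma sum_slope_le :
  T / N%:R * (\sum_(0 <= k < N) enorm (slope T N X k)) <= osc_bound.
Proof.
have := discrete_energy.
have : - (T * K0) <= T / N%:R *
    (\sum_(0 <= k < N) inner (h (grid T N k) (X k.+1)) (X k.+1)).
  have -> : - (T * K0) = T / N%:R * (\sum_(0 <= k < N) - K0).
    rewrite sumr_const_nat subn0 -[- K0 *+ N]mulr_natr.
    by field; rewrite gt_eqF.
  apply: ler_wpM2l; first exact: ltW.
  apply: ler_sum_nat => k /andP[_ kN]; apply: h_ge; apply: grid_in => //.
  exact: ltnW.
rewrite /osc_bound mulrDr; lra.
Qed.

Lemma step_slope k : X k.+1 - X k = (T / N%:R) *: slope T N X k.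
Proof.
by rewrite scalerA mulrA divfK ?gt_eqF // divff ?gt_eqF // scale1r.
Qed.

Lemma solution_osc k : (k <= N)%N -> `|X k - X 0%N| <= osc_bound.
Proof.
move=> kN; apply: le_trans sum_slope_le.
rewrite -telescope_sumr // mulr_sumr.
apply: le_trans (ler_norm_sum _ _ _) _.
rewrite [leRHS](big_cat_nat (n := k)) //= -[leLHS]addr0; apply: lerD.
  apply: ler_sum => l _; rewrite step_slope normrZ gtr0_norm //.
  by apply: ler_wpM2l; [exact: ltW|exact: norm_le_enorm].
by apply: sumr_ge0 => l _; apply: mulr_ge0; [exact: ltW|exact: enorm_ge0].
Qed.

(** The increments of [W] sum to zero over a period. *)
Lemma no_common_direction v :
  (forall k, (k < N)%N -> 0 <= inner (h (grid T N k) (X k.+1)) v) ->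
  (forall k, (k < N)%N -> 0 < inner (X k.+1) v) -> False.
Proof.
move=> hv Xv; have [XN WN _ WS] := sol.
have S0 : \sum_(0 <= k < N) inner (W k.+1 - W k) v = 0.
  under eq_bigr => k _ do rewrite innerBl.
  by rewrite telescope_sumr // WN subrr.
have : \sum_(0 <= k < N) 0 < \sum_(0 <= k < N) inner (W k.+1 - W k) v.
  apply: ltr_sum_nat => // k /andP[_ kN].
  rewrite WS // innerZl mulr_gt0 // innerDl innerZl ltr_wpDl ?hv //.
  by rewrite mulr_gt0 // Xv.
by rewrite big1_eq S0 ltxx.
Qed.

Lemma start_bound_coercive (r : R) :
  (forall t x, t \in `[0, T] -> r < enorm x -> M < inner (h t x) x) ->
  `|X 0%N| <= `|r| + osc_bound.
Proof.
move=> hr.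
suff [k kN kr] : exists2 k, (k < N)%N & enorm (X k.+1) <= r.
  have := solution_osc kN; have := norm_le_enorm (X k.+1); have := ler_norm r.
  have := lerB_dist (X 0%N) (X k.+1); rewrite [X in _ <= X -> _]distrC; lra.
apply: contrapT => H; have := discrete_energy.
have S1 : 0 <= T / N%:R * (\sum_(0 <= k < N) enorm (slope T N X k)).
  apply: mulr_ge0; first exact: ltW.
  by apply: sumr_ge0 => k _; exact: enorm_ge0.
have : T * M < T / N%:R * (\sum_(0 <= k < N) inner (h (grid T N k) (X k.+1)) (X k.+1)).
  have -> : T * M = T / N%:R * (\sum_(0 <= k < N) M).
    rewrite sumr_const_nat subn0 -[M *+ N]mulr_natr.
    by field; rewrite gt_eqF.
  rewrite ltr_pM2l //; apply: ltr_sum_nat => // k /andP[_ kN].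
  apply: hr; first by apply: grid_in => //; exact: ltnW.
  by rewrite ltNge; apply/negP => kr; apply: H; exists k.
lra.
Qed.

Lemma start_bound_translates (rho r : R) : n%:R * osc_bound <= rho ->
  (forall t x y, t \in `[0, T] ->
    r < enorm x -> enorm y <= rho -> 0 <= inner (h t (x + y)) x) ->
  `|X 0%N| <= Num.max r (n%:R * osc_bound).
Proof.
move=> rho_ge hr; rewrite leNgt; apply/negP.
move=> /lt_le_trans /(_ (norm_le_enorm _)); rewrite gt_max => /andP[e1 e2].
have dist k : (k < N)%N -> `|X k.+1 - X 0%N| <= osc_bound by move=> kN; exact: solution_osc.
apply: (@no_common_direction (X 0%N)) => k kN.
  rewrite -(subrKC (X 0%N) (X k.+1)); apply: hr => //.
    by apply: grid_in => //; exact: ltnW.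
  apply: le_trans (enorm_le_norm _) (le_trans _ rho_ge).
  by rewrite ler_wpM2l // dist.
have e0 : 0 < enorm (X 0%N).
  by apply: le_lt_trans e2; rewrite mulr_ge0 // ltW // osc_bound_gt0.
rewrite -(subrK (X 0%N) (X k.+1)) innerDl.
have -> : inner (X 0%N) (X 0%N) = enorm (X 0%N) * enorm (X 0%N).
  by rewrite -expr2 sqr_sqrtr // inner_ge0.
have : `|inner (X k.+1 - X 0%N) (X 0%N)| <= n%:R * osc_bound * enorm (X 0%N).
  apply: le_trans (abs_inner_le _ _) _; rewrite -mulrA ler_wpM2l //.
  by apply: ler_pM => //; [exact: dist|exact: norm_le_enorm].
rewrite ler_norml => /andP[H _].
have : n%:R * osc_bound * enorm (X 0%N) < enorm (X 0%N) * enorm (X 0%N) by rewrite ltr_pM2r.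
lra.
Qed.

Lemma start_bound_coordinates (d : R) : 0 < d ->
  (forall (i : 'I_n) t (x : 'rV[R]_n), t \in `[0, T] ->
    d < `|x 0 i| -> 0 <= h t x 0 i * x 0 i) ->
  `|X 0%N| <= d + osc_bound.
Proof.
move=> d0 hd; have o0 := osc_bound_gt0.
apply/mx_norm_leP => [|a i]; first by rewrite ltW // addr_gt0.
rewrite (ord1 a) leNgt; apply/negP => big.
have inner_i u : inner u (X 0%N 0 i *: delta_mx 0 i) = u 0 i * X 0%N 0 i.
  rewrite innerZr /inner (bigD1 i) //= mxE !eqxx mulr1 big1 ?addr0 1?mulrC // => j ji.
  by rewrite mxE (negPf ji) andbF mulr0.
have key k : (k < N)%N -> d < `|X k.+1 0 i| /\ 0 < X k.+1 0 i * X 0%N 0 i.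
  move=> kN; have := solution_osc kN => /(le_trans (mx_entry_le _ 0 i)); rewrite !mxE.
  move: big; set a0 := X 0%N 0 i; set a1 := X k.+1 0 i.
  rewrite ler_norml => big /andP[H1 H2]; move: big.
  have [a0p|a0n] := leP 0 a0.
    rewrite ger0_norm // => big; have a1p : d < a1 by lra.
    by split; [rewrite gtr0_norm //; lra|apply: mulr_gt0; lra].
  rewrite ltr0_norm // => big; have a1p : a1 < - d by lra.
  by split; [rewrite ltr0_norm //; lra|rewrite nmulr_rgt0; lra].
apply: (@no_common_direction (X 0%N 0 i *: delta_mx 0 i)) => k kN;
  rewrite inner_i; have [k1 k2] := key k kN => //.
have := hd i (grid T N k) (X k.+1) _ k1.
rewrite grid_in //; last exact: ltnW.
move=> /(_ isT) H; have H3 : 0 <= (h (grid T N k) (X k.+1) 0 i * X k.+1 0 i) *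
  (X k.+1 0 i * X 0%N 0 i) by rewrite mulr_ge0 // ltW.
have sq : 0 < X k.+1 0 i ^+ 2.
  by rewrite exprn_even_gt0 //= -normr_gt0 (lt_trans d0).
rewrite -(pmulr_rge0 _ sq); apply: le_trans H3 _.
by rewrite le_eqVlt; apply/orP; left; apply/eqP; ring.
Qed.

Section Lipschitz.
Variables (B H Bphi Bg L : R) (psi : 'rV[R]_n -> 'rV[R]_n).
Hypothesis eps_le1 : eps <= 1.
Hypothesis X_le : forall k, (k <= N)%N -> `|X k| <= B.
Hypothesis h_le : forall t x, t \in `[0, T] -> `|x| <= B -> `|h t x| <= H.
Hypothesis g_le : forall u v, `|u| <= B -> `|v| <= B -> `|g u v| <= Bg.
Hypothesis phi_le : forall y, `|y| <= M + K0 -> `|phi y| <= Bphi.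
Hypothesis phiK : cancel phi psi.

(** The first three terms bound [W] at an index where the slope is at most
    [M + K0], the bound for the mean slope; the last one bounds the total
    variation of [W]. *)
Definition W_bound : R := Bphi + Bg + BP + T * (H + B).

Hypothesis psi_le : forall z, `|z| <= W_bound + Bg + BP -> `|psi z| <= L.

Lemma W_step k : (k < N)%N -> `|W k.+1 - W k| <= T / N%:R * (H + B).
Proof.
move=> kN; have [_ _ _ WS] := sol; rewrite WS // normrZ gtr0_norm //.
apply: ler_wpM2l; first exact: ltW.
apply: le_trans (ler_normD _ _) _; apply: lerD.
  by apply: h_le; [apply: grid_in => //; exact: ltnW|exact: X_le].
rewrite normrZ gtr0_norm //; apply: le_trans (X_le kN).
by rewrite ler_piMl.
Qed.

Lemma W_dist j k : (j <= k)%N -> (k <= N)%N -> `|W k - W j| <= T * (H + B).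
Proof.
move=> jk kN; rewrite -telescope_sumr //.
have HB : 0 <= H + B.
  by have := le_trans (normr_ge0 _) (W_step N_gt0); rewrite pmulr_rge0.
apply: le_trans (ler_norm_sum _ _ _) _.
apply: (@le_trans _ _ (\sum_(j <= i < k) T / N%:R * (H + B))).
  apply: ler_sum_nat => i /andP[_ ik]; apply: W_step; exact: leq_trans kN.
rewrite sumr_const_nat -[_ *+ (k - j)]mulr_natr.
have -> : T / N%:R * (H + B) * (k - j)%:R = T * (H + B) * ((k - j)%:R / N%:R).
  by field; rewrite gt_eqF.
apply: ler_piMr; first by rewrite mulr_ge0 // ltW.
rewrite ler_pdivrMr // mul1r ler_nat.
exact: leq_trans (leq_subr _ _) kN.
Qed.

Lemma W_le k : (k <= N)%N -> `|W k| <= W_bound.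
Proof.
move=> kN.
have [l lN lM] : exists2 l, (l < N)%N & enorm (slope T N X l) <= M + K0.
  apply: contrapT => C; have := sum_slope_le; rewrite leNgt; case/negP.
  have -> : osc_bound = T / N%:R * (\sum_(0 <= k < N) (M + K0)).
    rewrite sumr_const_nat subn0 -[_ *+ N]mulr_natr /osc_bound.
    by field; rewrite gt_eqF.
  rewrite ltr_pM2l //; apply: ltr_sum_nat => // l /andP[_ lN].
  by rewrite ltNge; apply/negP => lM; apply: C; exists l.
have Wl : `|W l| <= Bphi + Bg + BP.
  have [_ _ -> // _] := sol.
  apply: le_trans (ler_normB _ _) _; apply: lerD; last first.
    by apply: P_le; apply: grid_in => //; exact: ltnW.
  apply: le_trans (ler_normB _ _) _; apply: lerD.
    by apply: phi_le; apply: le_trans (norm_le_enorm _) lM.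
  by apply: g_le; apply: X_le => //; exact: ltnW.
rewrite -(subrK (W l) (W k)) addrC; apply: le_trans (ler_normD _ _) (lerD Wl _).
have [lk|kl] := leqP l k; first exact: W_dist.
by rewrite distrC; apply: W_dist; exact: ltnW.
Qed.

Lemma slope_le k : (k < N)%N -> `|slope T N X k| <= L.
Proof.
move=> kN; rewrite -(phiK (slope T N X k)); apply: psi_le.
have [_ _ WE _] := sol; have := WE k kN => /(congr1 (fun z => z + P (grid T N k))).
rewrite subrK => /(congr1 (fun z => z + g (X k) (X k.+1))); rewrite subrK => <-.
apply: le_trans (ler_normD _ _) _; rewrite addrAC; apply: lerD; last first.
  by apply: g_le; apply: X_le => //; exact: ltnW.
apply: le_trans (ler_normD _ _) _; apply: lerD; first by apply: W_le; exact: ltnW.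
by apply: P_le; apply: grid_in => //; exact: ltnW.
Qed.

End Lipschitz.

End OneSolution.

End APriori.

(** * Passing to the limit *)

Lemma between_near (R : realType) (t s d tau p q l : R) :
  `|p - t| <= tau -> `|q - s| <= tau -> `|s - t| < d / 2 -> tau < d / 2 ->
  p <= l \/ q <= l -> l <= p \/ l <= q -> `|l - t| < d.
Proof.
rewrite !ler_norml !ltr_norml => /andP[p1 p2] /andP[q1 q2] /andP[s1 s2] h.
move=> lo hi; apply/andP; split; [case: lo => lo|case: hi => hi]; lra.
Qed.

Section Limit.
Context {R : realType}.
Variables (T : R) (U : set_system nat).
Hypothesis T_gt0 : 0 < T.
Hypothesis UU : UltraFilter U.
Hypothesis ooU : \oo `<=` U.

(** The pairs (mesh index, grid index) whose grid time tends to [t] while the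
    mesh runs along [U].  Convergence along this filter is locally uniform
    convergence near [t], so it passes through continuous maps. *)
Definition grid_filter (t : R) : set_system (nat * nat) :=
  [set A | exists2 d : R, 0 < d & \forall m \near U,
     forall k, (k < m.+1)%N -> `|grid T m.+1 k - t| < d -> A (m, k)].

Definition grid_index (t : R) (m : nat) : nat :=
  minn m (Num.truncn (t * m.+1%:R / T)).

Let mR0 m : 0 < m.+1%:R :> R. Proof. by rewrite ltr0n. Qed.

Lemma grid_index_lt t m : (grid_index t m < m.+1)%N.
Proof. by rewrite ltnS geq_minl. Qed.

Lemma grid_index_near t m : t \in `[0, T] ->
  `|grid T m.+1 (grid_index t m) - t| <= T / m.+1%:R.
Proof.
rewrite in_itv /= => /andP[t0 tT].
have q0 : 0 <= t * m.+1%:R / T by apply: divr_ge0; [exact: mulr_ge0|exact: ltW].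
have := truncn_itv q0; set q := Num.truncn _ => /andP[q1 q2].
have tE : t = (t * m.+1%:R / T) * T / m.+1%:R.
  by rewrite divfK ?gt_eqF // mulfK // gt_eqF.
have qm : t * m.+1%:R / T <= m.+1%:R.
  by rewrite ler_pdivrMr // mulrC ler_pM2l.
have -> : grid T m.+1 (grid_index t m) - t =
    ((grid_index t m)%:R - t * m.+1%:R / T) * (T / m.+1%:R).
  by rewrite /grid {2}tE; ring.
rewrite normrM [X in _ * X]gtr0_norm ?divr_gt0 //.
apply: ler_piMl; first by rewrite ltW // divr_gt0.
rewrite /grid_index -/q; move: q1 q2 qm; set z := _ / T; rewrite -!natr1.
move=> q1 q2 zm; rewrite ler_norml; case: (leqP m q) => [|_].
  by rewrite -(ler_nat R) => mq; apply/andP; split; lra.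
by apply/andP; split; lra.
Qed.

Lemma small_mesh (c e : R) : 0 < e -> \forall m \near U, c * (T / m.+1%:R) < e.
Proof.
move=> e0; apply: ooU; near=> m.
rewrite mulrA ltr_pdivrMr // -ltr_pdivrMl //.
apply: (@lt_trans _ _ m%:R); last by rewrite ltr_nat.
by near: m; exact: nbhs_infty_gtr.
Unshelve. all: by end_near. Qed.

Lemma grid_filter_filter t : Filter (grid_filter t).
Proof.
split.
- by exists 1 => //; apply: nearW.
- move=> A B [d d0 HA] [d' d0' HB]; exists (Num.min d d').
    by rewrite lt_min d0.
  apply: filterS2 HA HB => m HA HB k km; rewrite lt_min => /andP[k1 k2].
  by split; [exact: HA|exact: HB].
- move=> A B AB [d d0 HA]; exists d => //; apply: filterS HA => m HA k km kt.
  by apply: AB; exact: HA.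
Qed.
Local Existing Instance grid_filter_filter.

Lemma grid_filter_cvg t : t \in `[0, T] ->
  (fun m => (m, grid_index t m)) @ U --> grid_filter t.
Proof.
move=> tT A [d d0 HA]; rewrite /= /nbhs /=.
apply: filterS2 HA (small_mesh 1 d0) => m HA Hm; apply: HA.
  exact: grid_index_lt.
by apply: le_lt_trans (grid_index_near m tT) _; rewrite mul1r in Hm.
Qed.

Lemma cvg_along_grid (V : topologicalType) (u : nat -> nat -> V) t (l : V) :
  t \in `[0, T] -> (fun mk => u mk.1 mk.2) @ grid_filter t --> l ->
  (fun m => u m (grid_index t m)) @ U --> l.
Proof. by move=> tT ul A lA; exact: (grid_filter_cvg tT (ul A lA)). Qed.

Lemma grid_cvg t : (fun mk => grid T mk.1.+1 mk.2) @ grid_filter t --> t.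
Proof.
apply/cvgrPdist_lt => e e0; exists e => //; apply: nearW => m k _ /=.
by rewrite distrC.
Qed.

Lemma meshM_cvg0 t (V : normedModType R) (u : nat -> nat -> V) (c : R) :
  (forall m k, (k < m.+1)%N -> `|u m k| <= c * (T / m.+1%:R)) ->
  (fun mk => u mk.1 mk.2) @ grid_filter t --> (0 : V).
Proof.
move=> uc; apply/cvgr0Pnorm_lt => e e0; exists 1 => //.
apply: filterS (small_mesh c e0) => m Hm k km _ /=.
exact: le_lt_trans (uc m k km) Hm.
Qed.

Section Increments.
Context {n : nat}.
Variables (a b : nat -> nat -> 'rV[R]_n).
Hypothesis ab : forall m k, (k < m.+1)%N ->
  a m k.+1 - a m k = (T / m.+1%:R) *: b m k.

Lemma increment_le m j k (c : 'rV[R]_n) (e : R) :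
  (j < m.+1)%N -> (k < m.+1)%N ->
  (forall l, (minn j k <= l < maxn j k)%N -> `|b m l - c| <= e) ->
  `|a m k - a m j - (grid T m.+1 k - grid T m.+1 j) *: c| <=
  e * `|grid T m.+1 k - grid T m.+1 j|.
Proof.
wlog jk : j k / (j <= k)%N => [H jm km Hl|jm km].
  have [jk|kj] := leqP j k; first exact: H.
  have := H k j (ltnW kj) km jm; rewrite minnC maxnC => /(_ Hl).
  rewrite (distrC (grid T m.+1 j)).
  rewrite -(opprB (grid T m.+1 k)) -(opprB (a m k)) scaleNr -opprD normrN.
  by [].
rewrite (minn_idPl jk) (maxn_idPr jk) => Hl.
have -> : grid T m.+1 k - grid T m.+1 j = \sum_(j <= l < k) (T / m.+1%:R).
  by rewrite sumr_const_nat -[_ *+ (k - j)]mulr_natl natrB // /grid; ring.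
have e0 : `|\sum_(j <= l < k) (T / m.+1%:R)| = \sum_(j <= l < k) (T / m.+1%:R).
  by rewrite ger0_norm // sumr_ge0 // => l _; rewrite divr_ge0 // ltW.
rewrite e0 -telescope_sumr // scaler_suml -sumrB mulr_sumr.
apply: le_trans (ler_norm_sum _ _ _) _; apply: ler_sum_nat => l /andP[jl lk].
rewrite ab ?(ltn_trans lk) // -scalerBr normrZ gtr0_norm ?divr_gt0 // mulrC.
by rewrite ler_pM2r ?divr_gt0 //; apply: Hl; rewrite jl.
Qed.

(** The sequences are Lipschitz uniformly in the mesh, so the limit along
    [U] at one grid index near [t] is a limit along [grid_filter t]. *)
Lemma increments_limit (B L : R) :
  (forall m k, (k < m.+1)%N -> `|a m k| <= B) ->
  (forall m k, (k < m.+1)%N -> `|b m k| <= L) ->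
  exists x : R -> 'rV[R]_n, forall t, t \in `[0, T] ->
    (fun mk => a mk.1 mk.2) @ grid_filter t --> x t.
Proof.
move=> aB bL.
have /choice [x Hx] : forall t : R, exists x : 'rV[R]_n,
    (fun m => a m (grid_index t m)) @ U --> x.
  move=> t; apply: (ultra_cvg_mx UU (B := B)).
  by apply: nearW => m; apply: aB; exact: grid_index_lt.
exists x => t tT; apply/cvgrPdist_lt => e e0.
pose K := `|L| + 1; have K0 : 0 < K by rewrite ltr_wpDl.
have e3 : 0 < e / 3 by rewrite divr_gt0.
exists (e / 3 / K); first by rewrite divr_gt0.
have /cvgrPdist_lt /(_ _ e3) := Hx t.
apply: filterS2 (small_mesh K e3) => m Hm Hxm k km kt /=.
have H := @increment_le m (grid_index t m) k 0 K (grid_index_lt t m) km.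
have {}H : `|a m k - a m (grid_index t m)| <=
    K * `|grid T m.+1 k - grid T m.+1 (grid_index t m)|.
  rewrite scaler0 subr0 in H; apply: H => l /andP[_ lk]; rewrite subr0.
  have lm : (l < m.+1)%N.
    by apply: (leq_trans lk); rewrite geq_max (ltnW (grid_index_lt t m)) (ltnW km).
  apply: le_trans (bL m l lm) _; apply: le_trans (ler_norm L) _.
  by rewrite /K lerDl.
have G1 := grid_index_near m tT.
have H2 : `|grid T m.+1 k - grid T m.+1 (grid_index t m)| <=
    e / 3 / K + T / m.+1%:R.
  rewrite -(subrK t (grid T m.+1 k)) -addrA; apply: le_trans (ler_normD _ _) _.
  by rewrite distrC in G1; apply: lerD => //; exact: ltW.
have H3 : K * `|grid T m.+1 k - grid T m.+1 (grid_index t m)| <=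
   e / 3 + K * (T / m.+1%:R).
  apply: le_trans (ler_wpM2l (ltW K0) H2) _.
  by rewrite mulrDr [K * (_ / K)]mulrC divfK ?gt_eqF.
have := ler_distD (a m (grid_index t m)) (x t) (a m k).
rewrite [`|a m (grid_index t m) - a m k|]distrC => H5.
apply: (le_lt_trans H5).
have -> : e = e / 3 + (e / 3 + e / 3) by field.
apply: ltrD => //; apply: le_lt_trans (le_trans H H3) _.
by rewrite ltrD2l.
Qed.

(** Near [t] every [b m l] is within [e] of [y t], so an increment of [a] between
    two grid times differs from its length times [y t] by at most [e] times
    its length.  This inequality survives the limit, without any integral. *)
Lemma increments_derivative (x y : R -> 'rV[R]_n) :
  (forall t, t \in `[0, T] -> (fun mk => a mk.1 mk.2) @ grid_filter t --> x t) ->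
  (forall t, t \in `[0, T] -> (fun mk => b mk.1 mk.2) @ grid_filter t --> y t) ->
  derivative_on 0 T x y.
Proof.
move=> ax bY; apply/derivative_onP => t tT e e0.
have /cvgrPdist_le /(_ e e0) [d d0 Hd] := bY t tT.
have d2 : 0 < d / 2 by rewrite divr_gt0.
exists (d / 2) => // s sT st.
pose D m := grid T m.+1 (grid_index s m) - grid T m.+1 (grid_index t m).
pose Q m := a m (grid_index s m) - a m (grid_index t m) - D m *: y t.
have QD : \forall m \near U, `|Q m| <= e * `|D m|.
  apply: filterS2 Hd (small_mesh 1 d2) => m Hm Hs; rewrite mul1r in Hs.
  apply: increment_le; [exact: grid_index_lt|exact: grid_index_lt|].
  move=> l /andP[l1 l2].
  have lm : (l < m.+1)%N.
    by apply: (leq_trans l2); rewrite geq_max (ltnW (grid_index_lt t m)) (ltnW (grid_index_lt s m)).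
  rewrite distrC; apply: (Hm l lm).
  have Gt := grid_index_near m tT; have Gs := grid_index_near m sT.
  have gle i j : (i <= j)%N -> grid T m.+1 i <= grid T m.+1 j.
    by move=> ij; rewrite /grid ler_pM2r ?invr_gt0 // ler_pM2r // ler_nat.
  apply: (between_near Gt Gs st Hs); apply/orP.
    by have /orP[/gle ->|/gle ->] : (grid_index t m <= l)%N ||
      (grid_index s m <= l)%N by [rewrite -geq_min]; rewrite ?orbT.
  by have /orP[/ltnW/gle ->|/ltnW/gle ->] : (l < grid_index t m)%N ||
    (l < grid_index s m)%N by [rewrite -leq_max]; rewrite ?orbT.
have gi r : r \in `[0, T] -> (fun m => grid T m.+1 (grid_index r m)) @ U --> r.
  move=> rT; apply: (@cvg_along_grid _ (fun m k => grid T m.+1 k)) => //.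
  exact: grid_cvg.
have ai r : r \in `[0, T] -> (fun m => a m (grid_index r m)) @ U --> x r.
  by move=> rT; apply: cvg_along_grid => //; exact: ax.
have DU : D @ U --> s - t by apply: cvgB; exact: gi.
have QU : Q @ U --> x s - x t - (s - t) *: y t.
  apply: cvgB; first by apply: cvgB; exact: ai.
  by apply: cvgZ; [exact: DU|exact: cvg_cst].
have F0 : (fun m => e * `|D m| - `|Q m|) @ U -->
    e * `|s - t| - `|x s - x t - (s - t) *: y t|.
  apply: cvgB; last exact: cvg_norm.
  by apply: cvgM; [exact: cvg_cst|exact: cvg_norm].
rewrite -subr_ge0; apply: (closed_cvg (fun z : R => 0 <= z) _ _ _ F0).
  exact: closed_ge.
by apply: filterS QD => m; rewrite subr_ge0.
Qed.

(** The grid indices of the filter stop one step before [T], hence the last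
    step, which is small, is added at the end. *)
Lemma limit_periodic (L : R) (x : R -> 'rV[R]_n) :
  (forall m, a m m.+1 = a m 0%N) ->
  (forall m k, (k < m.+1)%N -> `|b m k| <= L) ->
  (forall t, t \in `[0, T] -> (fun mk => a mk.1 mk.2) @ grid_filter t --> x t) ->
  x 0 = x T.
Proof.
move=> per bL ax.
have t0 : 0 \in `[0, T] by rewrite in_itv /= lexx ltW.
have tT : T \in `[0, T] by rewrite in_itv /= lexx ltW.
have i0 m : grid_index 0 m = 0%N by rewrite /grid_index !mul0r truncn0 minn0.
have iT m : grid_index T m = m.
  by rewrite /grid_index mulrAC divff ?gt_eqF // mul1r natrK; apply/minn_idPl.
have a0 : (fun m => a m 0%N) @ U --> x 0.
  have : (fun m => a m (grid_index 0 m)) @ U --> x 0.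
    by apply: cvg_along_grid => //; exact: ax.
  by under eq_fun do rewrite i0.
have aT : (fun m => a m m) @ U --> x T.
  have : (fun m => a m (grid_index T m)) @ U --> x T.
    by apply: cvg_along_grid => //; exact: ax.
  by under eq_fun do rewrite iT.
have dT : (fun m => a m m.+1 - a m m) @ U --> (0 : 'rV[R]_n).
  apply/cvgr0Pnorm_lt => e e0; apply: filterS (small_mesh L e0) => m Hm.
  apply: le_lt_trans Hm; rewrite ab // normrZ gtr0_norm ?divr_gt0 // mulrC.
  by rewrite ler_pM2r ?divr_gt0 // bL.
have aT' : (fun m => a m 0%N) @ U --> x T.
  have -> : (fun m => a m 0%N) = (fun m => a m m.+1 - a m m) + (fun m => a m m).
    by apply/funext => m; rewrite addrfctE subrK per.
  by rewrite -[x T]add0r; apply: cvgD.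
exact: (norm_cvg_unique a0 aT').
Qed.

End Increments.

Lemma cvg_succ n (a : nat -> nat -> 'rV[R]_n) (c t : R) (l : 'rV[R]_n) :
  (forall m k, (k < m.+1)%N -> `|a m k.+1 - a m k| <= c * (T / m.+1%:R)) ->
  (fun mk => a mk.1 mk.2) @ grid_filter t --> l ->
  (fun mk => a mk.1 mk.2.+1) @ grid_filter t --> l.
Proof.
move=> ac al.
have -> : (fun mk => a mk.1 mk.2.+1) =
    (fun mk : nat * nat => a mk.1 mk.2.+1 - a mk.1 mk.2) + (fun mk => a mk.1 mk.2).
  by apply/funext => mk; rewrite addrfctE subrK.
rewrite -[l]add0r; apply: cvgD => //.
exact: (meshM_cvg0 t (u := fun m k => a m k.+1 - a m k) ac).
Qed.

End Limit.

Unset Implicit Arguments.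
Set Strict Implicit.
Set Printing Implicit Defensive.

Theorem theorem3p5 (R : realType) (n : nat) (hn : (1 <= n)%N)
  (T : R) (hT : 0 < T)
  (phi : 'rV[R]_n -> 'rV[R]_n)
  (phi_homeo : homeomorphism phi)
  (phi0 : phi 0 = 0)
  (phi_pos : forall xi : 'rV[R]_n, xi <> 0 -> 0 < inner (phi xi) xi)
  (phi_coercive : forall eta : R, 0 < eta -> exists M : R, 0 < M /\
    forall xi : 'rV[R]_n, eta * enorm xi - M <= inner (phi xi) xi)
  (G : 'rV[R]_n -> R) (G_C2 : class_C2 G)
  (p : R -> 'rV[R]_n)
  (p_cont : {within `[0, T], continuous p})
  (p_int : forall i : 'I_n,
    \int[@lebesgue_measure R]_(t in `[0, T]) (p t 0 i) = 0)
  (h : R -> 'rV[R]_n -> 'rV[R]_n)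
  (h_cont : {within `[0, T] `*` [set: 'rV[R]_n],
    continuous (fun z : R * 'rV[R]_n => h z.1 z.2)})
  (h_bound : exists K0 : R, 0 < K0 /\
    forall (t : R) (x : 'rV[R]_n), t \in `[0, T] -> - K0 <= inner (h t x) x)
  (h_cond :
    [\/ (* (i) *)
        forall A : R, exists r : R, forall (t : R) (x : 'rV[R]_n),
          t \in `[0, T] -> r < enorm x -> A < inner (h t x) x,
        (* (ii) *)
        forall rho : R, 0 < rho -> exists Rrho : R, 0 < Rrho /\
          forall (t : R) (x y : 'rV[R]_n), t \in `[0, T] ->
            Rrho < enorm x -> enorm y <= rho -> 0 <= inner (h t (x + y)) x
      | (* (iii) *)
        exists d : R, 0 < d /\ forall (i : 'I_n) (t : R) (x : 'rV[R]_n),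
          t \in `[0, T] -> d < `|x 0 i| -> 0 <= h t x 0 i * x 0 i]) :
  exists x : R -> 'rV[R]_n, periodic_solution T phi G h p x.
Proof.
have [phi_cont [psi [psi_cont phiK psiK]]] := phi_homeo.
have [K0 [K0_gt0 h_ge]] := h_bound.
have [P dP PT] := primitive_exists hT p_cont p_int.
have P_cont := derivative_on_continuous dP.
have t0 : 0 \in `[0, T] by rewrite in_itv /= lexx ltW.
have [BP BP_le] := compact_image_bounded (@segment_compact _ 0 T) P_cont.
have BP_ge0 : 0 <= BP by apply: le_trans (normr_ge0 _) (BP_le 0 t0).
have [|M [M_gt0 phi_coer]] := phi_coercive (n%:R * BP + 1).
  by rewrite ltr_wpDl // mulr_ge0.
have [G1 G2] := G_C2.
pose g := diffquot G; have g_cont := diffquot_continuous G1.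
have gG u v : G v - G u = inner (g u v) (v - u) by exact: diffquot_inner.
have h_cvg (S : Type) (L : set_system S) (FL : Filter L) (s : S -> R)
    (y : S -> 'rV[R]_n) (t : R) (x : 'rV[R]_n) : t \in `[0, T] -> s @ L --> t -> y @ L --> x ->
    (\forall a \near L, s a \in `[0, T]) -> (fun a => h (s a) (y a)) @ L --> h t x.
  move=> tT st yx sT.
  apply: (within_cvg (u := fun a => (s a, y a)) (z := (t, x)) h_cont) => //.
    exact: (cvg_pair st yx).
  by apply: filterS sT.
have h_contx t : t \in `[0, T] -> continuous (h t).
  move=> tT x; apply: (h_cvg _ (nbhs (x : 'rV[R]_n)) (nbhs_filter _) (fun=> t) id) => //.
    exact: cvg_cst.
  exact: nearW.
pose sol := discrete_solution T phi g h P.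
have [B0 HB0] : exists B0 : R, forall N eps X W, (0 < N)%N -> 0 < eps ->
    sol N eps X W -> `|X 0%N| <= B0.
  have o0 := osc_bound_gt0 hT M_gt0 K0_gt0.
  case: h_cond => [/(_ M)[r Hr]|H|[d [d0 Hd]]].
  - exists (`|r| + osc_bound T M K0) => N eps X W N0 e0 s.
    exact: (start_bound_coercive hT gG phi_coer BP_le h_ge N0 e0 s Hr).
  - have [|r [r0 Hr]] := H (n%:R * osc_bound T M K0).
      by rewrite mulr_gt0 // ltr0n.
    exists (Num.max r (n%:R * osc_bound T M K0)) => N eps X W N0 e0 s.
    exact: (start_bound_translates hT gG M_gt0 K0_gt0 phi_coer BP_le h_ge N0 e0 s (lexx _) Hr).
  - exists (d + osc_bound T M K0) => N eps X W N0 e0 s.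
    exact: (start_bound_coordinates hT gG M_gt0 K0_gt0 phi_coer BP_le h_ge N0 e0 s d0 Hd).
pose B := B0 + osc_bound T M K0.
have XB N eps X W : (0 < N)%N -> 0 < eps -> sol N eps X W ->
    forall k, (k <= N)%N -> `|X k| <= B.
  move=> N0 e0 s k kN; rewrite -(subrK (X 0%N) (X k)) addrC.
  apply: le_trans (ler_normD _ _) _; apply: lerD; first exact: HB0 s.
  exact: (solution_osc hT gG phi_coer BP_le h_ge N0 e0 s kN).
have [H HH] : exists H : R, forall t x, t \in `[0, T] -> `|x| <= B -> `|h t x| <= H.
  have [H HH] : exists H : R, forall z,
      (`[0, T]%classic `*` [set x : 'rV[R]_n | `|x| <= B]) z -> `|h z.1 z.2| <= H.
    apply: compact_image_bounded.
      by apply: compact_setX; [exact: segment_compact|exact: closed_ball_compact].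
    by apply: (continuous_subspaceW _ h_cont) => z [].
  by exists H => t x tT xB; apply: (HH (t, x)).
have [Bg Hg] := bounded_on_ball2 B g_cont.
have [Bphi Hphi] := bounded_on_ball (M + K0) phi_cont.
pose BW := W_bound T BP B H Bphi Bg.
have [L HL] := bounded_on_ball (BW + Bg + BP) psi_cont.
have eps0 m : 0 < m.+1%:R^-1 :> R by rewrite invr_gt0 ltr0n.
have eps1 m : m.+1%:R^-1 <= 1 :> R by rewrite invf_le1 ?ltr0n // ler1n.
have /choice [X HX] : forall m, exists X, exists W, sol m.+1 m.+1%:R^-1 X W.
  move=> m.
  exact: (discrete_solution_exists hT gG M_gt0 K0_gt0 phi_coer BP_le h_ge
    phi_cont g_cont h_contx (ltn0Sn m) (eps0 m)).
have /choice [W HW] := HX.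
have X_le m k : (k <= m.+1)%N -> `|X m k| <= B by move=> km; exact: XB (HW m) _ km.
have W_le m k : (k <= m.+1)%N -> `|W m k| <= BW.
  move=> km; exact: (W_le hT gG phi_coer BP_le h_ge (ltn0Sn m) (eps0 m) (HW m)
    (eps1 m) (X_le m) HH Hg Hphi km).
have Y_le m k : (k < m.+1)%N -> `|slope T m.+1 (X m) k| <= L.
  move=> km; exact: (slope_le hT gG phi_coer BP_le h_ge (ltn0Sn m) (eps0 m)
    (HW m) (eps1 m) (X_le m) HH Hg Hphi phiK HL km).
pose Y m k := slope T m.+1 (X m) k.
pose V m k := h (grid T m.+1 k) (X m k.+1) + m.+1%:R^-1 *: X m k.+1.
have XY m k : (k < m.+1)%N -> X m k.+1 - X m k = (T / m.+1%:R) *: Y m k.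
  by move=> _; exact: step_slope.
have WV m k : (k < m.+1)%N -> W m k.+1 - W m k = (T / m.+1%:R) *: V m k.
  by move=> km; have [_ _ _] := HW m; exact.
have V_le m k : (k < m.+1)%N -> `|V m k| <= H + B.
  move=> km; apply: le_trans (ler_normD _ _) _; apply: lerD.
    by apply: HH; [apply: grid_in => //; exact: ltnW|exact: X_le].
  rewrite normrZ gtr0_norm //; apply: le_trans (X_le m k.+1 km).
  exact: ler_piMl.
have [U [UU ooU]] := exists_ultra_nat.
pose F := grid_filter T U.
have FF t : Filter (F t) by exact: grid_filter_filter.
have [x Hx] := increments_limit hT UU ooU XY
  (fun m k km => X_le m k (ltnW km)) Y_le.
have [w Hw] := increments_limit hT UU ooU WV
  (fun m k km => W_le m k (ltnW km)) V_le.
have HxS t : t \in `[0, T] -> (fun mk => X mk.1 mk.2.+1) @ F t --> x t.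
  move=> tT; apply: (cvg_succ UU ooU (c := L)); last exact: Hx.
  move=> m k km; rewrite XY // normrZ gtr0_norm ?divr_gt0 // mulrC.
  by apply: ler_wpM2r; [rewrite divr_ge0 // ltW|exact: Y_le].
have grad_cont (u : 'rV[R]_n) : grad G @ u --> grad G u.
  have -> : grad G = (fun v => g v v).
    by apply/funext => v; rewrite /g diffquot_diag.
  exact: (@cvg_continuous2 _ _ _ _ (nbhs u) (nbhs_filter u) g id id u u).
pose y t := psi (w t + grad G (x t) + P t).
have HY t : t \in `[0, T] -> (fun mk => Y mk.1 mk.2) @ F t --> y t.
  move=> tT.
  have lim : (fun mk => psi (W mk.1 mk.2 + g (X mk.1 mk.2) (X mk.1 mk.2.+1) +
      P (grid T mk.1.+1 mk.2))) @ F t --> y t.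
    apply: (@cvg_comp _ _ _ _ psi _ _ _ _ (psi_cont _)).
    apply: cvgD; last first.
      apply: (within_cvg (u := fun mk => grid T mk.1.+1 mk.2) P_cont tT).
        refine (@grid_cvg R T U UU t).
      exists 1 => //; apply: nearW => m k km _ /=.
      by apply: grid_in => //; exact: ltnW.
    apply: cvgD; first exact: Hw.
    rewrite -(diffquot_diag G (x t)).
    by apply: cvg_continuous2; [exact: g_cont|exact: Hx|exact: HxS].
  apply: cvg_trans lim; apply: near_eq_cvg.
  exists 1 => //; apply: nearW => m k km _ /=.
  by have [_ _ -> // _] := HW m; rewrite addrAC !subrK phiK.
have HV t : t \in `[0, T] -> (fun mk => V mk.1 mk.2) @ F t --> h t (x t).
  move=> tT; rewrite -[h t (x t)]addr0; apply: cvgD.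
    apply: h_cvg => //; [refine (@grid_cvg R T U UU t)|exact: HxS|].
    exists 1 => //; apply: nearW => m k km _ /=.
    by apply: grid_in => //; exact: ltnW.
  apply: (meshM_cvg0 UU ooU t (u := fun m k => m.+1%:R^-1 *: X m k.+1) (c := B / T)).
  move=> m k km; rewrite normrZ gtr0_norm // mulrA divfK ?gt_eqF // mulrC.
  by apply: ler_wpM2r; [exact: ltW|exact: X_le].
have dx : derivative_on 0 T x y := increments_derivative hT UU ooU XY Hx HY.
have dw : derivative_on 0 T w (fun t => h t (x t)) :=
  increments_derivative hT UU ooU WV Hw HV.
have xT : x 0 = x T.
  by apply: (limit_periodic hT UU ooU XY _ Y_le Hx) => m; have [] := HW m.
have wT : w 0 = w T.
  by apply: (limit_periodic hT UU ooU WV _ V_le Hw) => m; have [] := HW m.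
pose gg i := diffquot (partial G i).
have gg_cont i : continuous (fun z : 'rV[R]_n * 'rV[R]_n => gg i z.1 z.2).
  exact: diffquot_continuous (G2 i).
pose dgrad t : 'rV[R]_n := \row_i inner (gg i (x t) (x t)) (y t).
have dG : derivative_on 0 T (grad G \o x) dgrad.
  apply: derivative_on_comp => // i u v.
  by rewrite !mxE; exact: diffquot_inner.
have x_cont := derivative_on_continuous dx.
have w_cont := derivative_on_continuous dw.
have x_cvg t : t \in `[0, T] -> x @ within `[0, T] (nbhs t) --> x t.
  by move=> tT; move/subspace_continuousP : x_cont; apply.
have y_cvg t : t \in `[0, T] -> y @ within `[0, T] (nbhs t) --> y t.
  move=> tT; apply: (@cvg_comp _ _ _ _ psi _ _ _ _ (psi_cont _)).
  apply: cvgD; last by move/subspace_continuousP : P_cont; apply.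
  apply: cvgD; first by move/subspace_continuousP : w_cont; apply.
  apply: (@cvg_comp _ _ _ x (grad G) _ _ _ (x_cvg t tT)); exact: grad_cont.
exists x, y, (fun t => h t (x t) + dgrad t + p t), dgrad; split.
- by split => //; apply/subspace_continuousP => t tT; exact: y_cvg.
- split.
    have phiy : phi \o y = (fun t => w t + grad G (x t) + P t).
      by apply/funext => t; rewrite /= /y psiK.
    rewrite phiy; apply: derivative_onD => //; exact: derivative_onD.
  apply/subspace_continuousP => t tT; apply: cvgD; last first.
    by move/subspace_continuousP : p_cont; apply.
  apply: cvgD.
    apply: h_cvg => //; [exact: cvg_within|exact: x_cvg|exact: withinT].
  apply/cvg_mxP => a i; rewrite (ord1 a) mxE.
  have -> : (fun s => dgrad s 0 i) = (fun s => \sum_j gg i (x s) (x s) 0 j * y s 0 j).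
    by apply/funext => s; rewrite mxE.
  apply: cvg_big => [|j _]; first exact: add_continuous.
  apply: cvgM; last by move/cvg_mxP : (y_cvg t tT); apply.
  have : (fun s => gg i (x s) (x s)) @ within `[0, T] (nbhs t) --> gg i (x t) (x t).
    by apply: cvg_continuous2; [exact: gg_cont|exact: x_cvg|exact: x_cvg].
  by move/cvg_mxP; apply.
- exact: dG.
- by move=> t tT; rewrite (addrC (dgrad t)).
- by split => //; rewrite /y xT wT PT.
Qed.
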